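(* Let $R$ be an Artinian Gorenstein local ring with maximal ideal $\mathfrak m$ and with Loewy length $\ell\ell(R) \geq 3$. Then the following are equivalent: (1) There are Artinian Gorenstein local rings $S$, $T$ with $\ell\ell(S) = \ell\ell(R)$ and $\ell\ell(T) = 2$ such that $R = S \# T$. (2) $(0 : \mathfrak m^2) \not\subseteq \mathfrak m^2$.
   Context: All rings are commutative Noetherian local rings with $1 \neq 0$. The Loewy length of an Artinian local ring $(R,\mathfrak m)$ is $\ell\ell(R) = \max\{n : \mathfrak m^n \neq 0\}$, and $(0:\mathfrak m^2)$ is the annihilator of $\mathfrak m^2$ in $R$. Connected sum: let $S, T$ be Artinian Gorenstein local rings (not fields) with common residue field $k$ and quotient maps $\pi_S : S\to k$, $\pi_T : T \to k$, and one-dimensional socles $\operatorname{soc}(S) = \langle \delta_S\rangle$, $\operatorname{soc}(T) = \langle\delta_T\rangle$. The fiber product is $S \times_k T = \{(s,t)\in S\times T : \pi_S(s)=\pi_T(t)\}$ and the connected sum is $S \# T = (S\times_k T)/\langle(\delta_S,-\delta_T)\rangle$ (for a choice of socle generators $\delta_S,\delta_T$). The equality $R = S\# T$ means that $R$ is isomorphic to such a connected sum. *)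

(* Defs.v *)
From HB Require Import structures.
From mathcomp Require Import all_boot all_algebra.
From mathcomp Require Import boolp classical_sets.

Set Implicit Arguments.
Unset Strict Implicit.
Unset Printing Implicit Defensive.

Import GRing.Theory.
Local Open Scope classical_set_scope.
Local Open Scope ring_scope.

(* Ideals are Prop-valued sets, and the unit ideal is allowed: the structure
   [idealr] of ring_quotient only covers proper ideals. *)

Section Ideals.
Variable R : comNzRingType.
Implicit Types I J m : set R.

Definition is_ideal I : Prop :=
  [/\ I 0, forall x y, I x -> I y -> I (x + y) & forall a x, I x -> I (a * x)].

Definition ideal_gen (X : set R) : set R := smallest is_ideal X.

Definition ideal_mul I J : set R :=
  ideal_gen [set x * y | x in I & y in J].

Definition ideal_exp I (n : nat) : set R := iter n (ideal_mul I) setT.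

(* (0 : I) *)
Definition ann I : set R := [set x | forall y, I y -> x * y = 0].

Definition maximal_ideal I : Prop :=
  [/\ is_ideal I, ~ I 1 &
      forall J, is_ideal J -> I `<=` J -> J = I \/ J = setT].

Definition is_local m : Prop := forall n : set R, maximal_ideal n <-> n = m.

Definition noetherian : Prop :=
  forall I, is_ideal I -> exists s : seq R, I = ideal_gen [set` s].

Definition artinian : Prop :=
  forall I : nat -> set R,
    (forall n, is_ideal (I n)) -> (forall n, I n.+1 `<=` I n) ->
    exists N, forall n, (N <= n)%N -> I n = I N.

(* Since m kills (0 : m), the ideal generated by d is the line spanned by d over
   the residue field: this says that the socle has dimension one with basis d. *)
Definition socle_generator m (d : R) : Prop :=
  d <> 0 /\ ann m = ideal_gen [set d].

(* For Artinian local rings, Gorenstein means that the socle is a line. *)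
Definition artinian_gorenstein_local m : Prop :=
  [/\ is_local m, noetherian, artinian & exists d, socle_generator m d].

(* The largest n with m ^ n <> 0; it exists when R is Artinian local, and the
   value is 0 if there is no largest such n. *)
Definition loewy_length m : nat :=
  xget 0%N [set n | ideal_exp m n <> [set 0] /\
                    forall k, ideal_exp m k <> [set 0] -> (k <= n)%N].

Definition residue_map (k : fieldType) m (p : {rmorphism R -> k}) : Prop :=
  (forall c : k, exists x : R, p x = c) /\ p @^-1` [set 0] = m.

End Ideals.

Arguments noetherian : clear implicits.
Arguments artinian : clear implicits.

Section FiberProduct.
Variables (k : fieldType) (S T : comNzRingType).
Variables (pS : {rmorphism S -> k}) (pT : {rmorphism T -> k}).

Definition fiber_pred : {pred S * T} := fun st => pS st.1 == pT st.2.

Lemma fiber_subring_closed : subring_closed fiber_pred.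
Proof.
split=> [|x y|x y]; rewrite !unfold_in /fiber_pred /=.
- by rewrite !rmorph1.
- by move=> /eqP ex /eqP ey; rewrite !rmorphB ex ey.
- by move=> /eqP ex /eqP ey; rewrite !rmorphM ex ey.
Qed.

HB.instance Definition _ :=
  GRing.isSubringClosed.Build (S * T)%type fiber_pred fiber_subring_closed.

Record fiber_product : Type :=
  FiberProduct { fiber_val :> S * T; _ : fiber_val \in fiber_pred }.

HB.instance Definition _ := [isSub for fiber_val].
HB.instance Definition _ := [Choice of fiber_product by <:].
HB.instance Definition _ :=
  [SubChoice_isSubComNzRing of fiber_product by <:].

End FiberProduct.

(* R is isomorphic to (S x_k T) / <(dS, - dT)> for some identification of both
   residue fields with a field k and some socle generators dS and dT. The
   quotient {ideal_quot I} takes a bundled boolean ideal I, which is required to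
   have the same elements as <(dS, - dT)>. *)
Definition is_connected_sum (R S T : comNzRingType) (mS : set S) (mT : set T)
    : Prop :=
  [/\ mS <> [set 0], mT <> [set 0] &
  exists (k : fieldType) (pS : {rmorphism S -> k}) (pT : {rmorphism T -> k}),
  [/\ residue_map mS pS, residue_map mT pT &
  exists (dS : S) (dT : T) (d : fiber_product pS pT),
  [/\ socle_generator mS dS, socle_generator mT dT,
      fiber_val d = (dS, - dT) &
  exists I : idealr (fiber_product pS pT),
    [set x | x \in I] = ideal_gen [set d] /\
    exists f : {rmorphism R -> {ideal_quot I}}, bijective f]]].

(* Main.v *)
Require Import Defs.
From HB Require Import structures.
From mathcomp Require Import all_boot all_algebra.
From mathcomp Require Import ring.
From mathcomp Require Import boolp classical_sets.

(* (1) => (2): for t in m_T \ m_T^2 the class of (0, t) kills m^2 but lies outside m^2.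

   (2) => (1): since R is Gorenstein, I = (0 : (0 : I)) for every ideal I.  Take an ideal W
   between (0 : m) and (0 : m^2) such that W / (0 : m) is a complement of
   ((0 : m^2) :&: m^2) / (0 : m), and put Z = (0 : W).  Then m = W + Z, W Z = 0 and
   W :&: Z = (0 : m) is the socle, so R / (0 : m) is the fiber product of R / W and R / Z;
   it remains to extend these two rings by the socle to rings S and T whose connected sum is
   R.  Multiplication of W-components is a symmetric form m x m -> (0 : m).

   Let pi : F -> R be a surjection, n = pi^-1 m, K = pi^-1 W and L = pi^-1 Z.  If F is
   regular enough for the form to factor through n^2 as a linear functional psi, then psi
   extends to L, the difference pi - psi extends from K :&: L = pi^-1 (0 : m) to K, and the
   kernels of these two functionals define T and S respectively.  No coefficient ring of R
   is needed: it suffices to take for F a ring that looks like a polynomial ring over the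
   integers on all elements of R, because adjoining a variable preserves the factorization
   property. *)

(** When R has a coefficient field k, the subrings k + Z and k + W already are S and T. In mixed
    characteristic the residue characteristic lies in m and may have both a W- and a Z-component, so
    S and T are built as quotients of a common cover instead. R cannot be its own cover: the socle
    generator [d] is a product [w0 * u0] with w0 in W, on which the form takes the value [d], and
    also a sum of products from m and m^2, on which the form vanishes; so the form is not a function
    on m^2. Over a regular local ring n^2 / n^3 is the second symmetric power of n / n^2, so a
    symmetric form on n that vanishes on n x n^2 does factor through n^2.

    The two socles come from one line: [e] in n^2 with psi e = d generates the socle of T, and [f]
    in n^l with pi f = d and psi f = 0 generates that of S. If pi x = 0 and psi x = c * d, then x
    maps to - c * f in S and to c * e in T, that is, to a multiple of (f, - e): the kernel of pi
    turns into exactly the relation that the connected sum imposes. *)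

Set Implicit Arguments.
Unset Strict Implicit.
Unset Printing Implicit Defensive.

Import GRing.Theory.
Local Open Scope classical_set_scope.
Local Open Scope ring_scope.

(** * Ideals *)

Lemma maximal_of_chains (T : Type) (P : set (set T)) :
    (exists A, P A) ->
    (forall C : set (set T), C !=set0 -> C `<=` P -> total_on C subset ->
       P (\bigcup_(X in C) X)) ->
  exists A, P A /\ forall B, P B -> A `<=` B -> B = A.
Proof.
move=> [A0 PA0] Pchain.
(* [Zorn_bigcup] also quantifies over the empty chain, whose union is empty; adjoining [set0] to P
   accounts for it. *)
have [C CP totC|A [PA Amax]] :=
  @Zorn_bigcup T [set A | A = set0 \/ P A].
  have [[X [CX PX]]|noX] := pselect (exists X, C X /\ P X); last first.
    left; apply/seteqP; split=> // x [X CX Xx].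
    have [X0|PX] := CP _ CX; first by rewrite X0 in Xx.
    by case: noX; exists X.
  right; have -> : \bigcup_(Y in C) Y = \bigcup_(Y in [set Y | C Y /\ P Y]) Y.
    apply/seteqP; split=> x [Y /= CY Yx]; last by exists Y => //; case: CY.
    have [Y0|PY] := CP _ CY; first by rewrite Y0 in Yx.
    by exists Y.
  apply: Pchain; [by exists X|by move=> Y []|].
  by move=> Y Z [CY _] [CZ _]; apply: totC.
have {}PA : P A.
  case: PA => // A_0; suff -> : A = A0 by [].
  apply: contrapT => AA0; apply: (Amax A0); last by right.
  split; first by rewrite A_0.
  by move=> A0A; apply: AA0; apply/seteqP; split; rewrite // A_0.
exists A; split=> // B PB AB; apply: contrapT => BA.
apply: (Amax B); last by right.
by split=> // BA'; apply: BA; apply/seteqP.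
Qed.

Section IdealTheory.
Variable R : comNzRingType.
Implicit Types (I J m : set R) (x y : R).

Lemma ideal_0 I : is_ideal I -> I 0. Proof. by case. Qed.

Lemma idealD I x y : is_ideal I -> I x -> I y -> I (x + y).
Proof. by case=> _ h _; apply: h. Qed.

Lemma ideal_mull I a x : is_ideal I -> I x -> I (a * x).
Proof. by case=> _ _ h; apply: h. Qed.

Lemma ideal_mulr I a x : is_ideal I -> I x -> I (x * a).
Proof. by move=> hI Ix; rewrite mulrC; apply: ideal_mull. Qed.

Lemma idealN I x : is_ideal I -> I x -> I (- x).
Proof. by move=> hI Ix; rewrite -mulN1r; apply: ideal_mull. Qed.

Lemma idealB I x y : is_ideal I -> I x -> I y -> I (x - y).
Proof. by move=> hI Ix Iy; apply: idealD => //; apply: idealN. Qed.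

Lemma idealDr_cancel I x y : is_ideal I -> I y -> I (x + y) -> I x.
Proof. by move=> hI Iy Ixy; rewrite -(addrK y x); apply: idealB. Qed.

Lemma idealB_cancel I x y : is_ideal I -> I y -> I (x - y) -> I x.
Proof. by move=> hI Iy Ixy; rewrite -(subrK y x); apply: idealD. Qed.

Lemma ideal_sum I (T : eqType) (s : seq T) (f : T -> R) : is_ideal I ->
  (forall t, t \in s -> I (f t)) -> I (\sum_(t <- s) f t).
Proof.
move=> hI sI; rewrite big_seq; elim/big_rec: _ => [|t x ts Ix].
  exact: ideal_0.
by apply: idealD => //; apply: sI.
Qed.

Lemma is_ideal_set0 : is_ideal [set 0 : R].
Proof.
by split=> [|x y /= -> ->|a x /= ->] /=; rewrite ?addr0 ?mulr0.
Qed.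

Lemma is_idealT : is_ideal [set: R]. Proof. by []. Qed.

Lemma is_idealI I J : is_ideal I -> is_ideal J -> is_ideal (I `&` J).
Proof.
move=> hI hJ; split=> [|x y [Ix Jx] [Iy Jy]|a x [Ix Jx]].
- by split; apply: ideal_0.
- by split; apply: idealD.
- by split; apply: ideal_mull.
Qed.

Definition ideal_add I J : set R := [set x + y | x in I & y in J].

Lemma is_ideal_add I J : is_ideal I -> is_ideal J -> is_ideal (ideal_add I J).
Proof.
move=> hI hJ; split.
- by exists 0; [exact: ideal_0|exists 0; [exact: ideal_0|rewrite addr0]].
- move=> _ _ [x Ix [y Jy <-]] [x' Ix' [y' Jy' <-]].
  exists (x + x'); first exact: idealD.
  by exists (y + y'); [exact: idealD|rewrite addrACA].
- move=> a _ [x Ix [y Jy <-]]; exists (a * x); first exact: ideal_mull.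
  by exists (a * y); [exact: ideal_mull|rewrite mulrDr].
Qed.

Lemma ideal_addl I J : is_ideal J -> I `<=` ideal_add I J.
Proof.
by move=> hJ x Ix; exists x => //; exists 0; [exact: ideal_0|rewrite addr0].
Qed.

Lemma ideal_addr I J : is_ideal I -> J `<=` ideal_add I J.
Proof.
by move=> hI x Jx; exists 0; [exact: ideal_0|exists x; rewrite ?add0r].
Qed.

Lemma ideal_add_sub I J K : is_ideal K -> I `<=` K -> J `<=` K ->
  ideal_add I J `<=` K.
Proof.
by move=> hK IK JK _ [x Ix [y Jy <-]]; apply: idealD => //; [exact: IK|exact: JK].
Qed.

Lemma is_ideal_gen (X : set R) : is_ideal (ideal_gen X).
Proof.
split=> [J [hJ _]|x y Ix Iy J [hJ XJ]|a x Ix J [hJ XJ]].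
- exact: ideal_0.
- by apply: idealD => //; [exact: Ix|exact: Iy].
- by apply: ideal_mull => //; exact: Ix.
Qed.

Lemma ideal_gen_sub (X : set R) : X `<=` ideal_gen X.
Proof. by move=> x Xx J [_ XJ]; exact: XJ. Qed.

Lemma ideal_gen_min (X : set R) J : is_ideal J -> X `<=` J -> ideal_gen X `<=` J.
Proof. by move=> hJ XJ x gx; apply: gx. Qed.

Lemma ideal_gen1 (d : R) : ideal_gen [set d] = [set a * d | a in setT].
Proof.
apply/seteqP; split.
  apply: ideal_gen_min; last by move=> _ ->; exists 1; rewrite ?mul1r.
  split; first by exists 0; rewrite ?mul0r.
  - by move=> _ _ [a _ <-] [b _ <-]; exists (a + b); rewrite ?mulrDl.
  - by move=> a _ [b _ <-]; exists (a * b); rewrite ?mulrA.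
move=> _ [a _ <-]; apply: (ideal_mull _ (is_ideal_gen _)).
exact: ideal_gen_sub.
Qed.

Lemma is_ideal_mul I J : is_ideal (ideal_mul I J).
Proof. exact: is_ideal_gen. Qed.

Lemma ideal_mul_sub I J x y : I x -> J y -> ideal_mul I J (x * y).
Proof. by move=> Ix Jy; apply: ideal_gen_sub; exists x => //; exists y. Qed.

Lemma ideal_mul_min I J K : is_ideal K ->
  (forall x y, I x -> J y -> K (x * y)) -> ideal_mul I J `<=` K.
Proof.
by move=> hK IJK; apply: ideal_gen_min => // _ [x Ix [y Jy <-]]; apply: IJK.
Qed.

Definition pairs_in I J (s : seq (R * R)) :=
  forall p, p \in s -> I p.1 /\ J p.2.

Lemma pairs_in_cat I J s t :
  pairs_in I J s -> pairs_in I J t -> pairs_in I J (s ++ t).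
Proof.
by move=> hs ht p; rewrite mem_cat => /orP[]; [exact: hs|exact: ht].
Qed.

Lemma pairs_in_scale I J a (s : seq (R * R)) : is_ideal I ->
  pairs_in I J s -> pairs_in I J [seq (a * p.1, p.2) | p <- s].
Proof.
move=> hI hs _ /mapP[p /hs[Ip Jp] ->] /=; split=> //; exact: ideal_mull.
Qed.

Lemma ideal_mulP I J x : is_ideal I ->
  ideal_mul I J x <->
  exists2 s, pairs_in I J s & x = \sum_(p <- s) p.1 * p.2.
Proof.
move=> hI; split; last first.
  move=> [s hs ->]; apply: ideal_sum => [|p /hs[]]; first exact: is_ideal_mul.
  exact: ideal_mul_sub.
move: x; apply: ideal_mul_min; last first.
  move=> x y Ix Jy; exists [:: (x, y)]; last by rewrite big_seq1.
  by move=> p; rewrite inE => /eqP ->.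
split.
- by exists [::] => //; rewrite big_nil.
- move=> _ _ [s hs ->] [t ht ->]; exists (s ++ t); last by rewrite big_cat.
  exact: pairs_in_cat.
- move=> a _ [s hs ->]; exists [seq (a * p.1, p.2) | p <- s].
    exact: pairs_in_scale.
  by rewrite big_map mulr_sumr; under [RHS]eq_bigr do rewrite /= -mulrA.
Qed.

Lemma is_ideal_exp I n : is_ideal (ideal_exp I n).
Proof. by case: n => [|n]; [exact: is_idealT|exact: is_ideal_mul]. Qed.

Lemma ideal_exp1 I : is_ideal I -> ideal_exp I 1 = I.
Proof.
move=> hI; apply/seteqP; split=> [|x Ix].
  by apply: ideal_mul_min => // x y Ix _; apply: ideal_mulr.
by rewrite -[x]mulr1; apply: ideal_mul_sub.
Qed.

Lemma ideal_expS_sub I n : ideal_exp I n.+1 `<=` ideal_exp I n.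
Proof.
apply: ideal_mul_min => [|x y _]; first exact: is_ideal_exp.
by apply: ideal_mull; exact: is_ideal_exp.
Qed.

Lemma ideal_exp_le I i j : (i <= j)%N -> ideal_exp I j `<=` ideal_exp I i.
Proof.
elim: j => [|j IHj]; first by rewrite leqn0 => /eqP ->.
rewrite leq_eqVlt => /orP[/eqP -> //|/IHj ij].
exact: subset_trans (@ideal_expS_sub I j) ij.
Qed.

Lemma ideal_exp2 I : is_ideal I -> ideal_exp I 2 = ideal_mul I I.
Proof. by move=> hI; congr (ideal_mul I _); exact: (ideal_exp1 hI). Qed.

Lemma ideal_exp2_sub I x y : is_ideal I -> I x -> I y -> ideal_exp I 2 (x * y).
Proof. by move=> hI Ix Iy; rewrite ideal_exp2 //; apply: ideal_mul_sub. Qed.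

Lemma is_ideal_ann I : is_ideal (ann I).
Proof.
split=> [y _|x x' hx hx' y Iy|a x hx y Iy]; first by rewrite mul0r.
- by rewrite mulrDl hx // hx' // addr0.
- by rewrite -mulrA hx // mulr0.
Qed.

Lemma annS I J : I `<=` J -> ann J `<=` ann I.
Proof. by move=> IJ x hx y /IJ; apply: hx. Qed.

Lemma ann_exp2 m x : is_ideal m -> (forall a b, m a -> m b -> x * (a * b) = 0) ->
  ann (ideal_exp m 2) x.
Proof.
move=> hm h y hy.
suff h2 : ideal_exp m 2 `<=` [set y | x * y = 0] by exact: h2.
rewrite ideal_exp2 //; apply: ideal_mul_min.
  split=> [|a b /= ha hb|a b /= hb]; rewrite /= ?mulr0 //.
    by rewrite mulrDr ha hb addr0.
  by rewrite mulrCA hb mulr0.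
exact: h.
Qed.

(** Maximality in a form that lifts along surjections. The cover F is not local, so for the preimage
    of m in F only this is available. *)
Definition residually_field m :=
  [/\ is_ideal m, ~ m 1 & forall c, ~ m c -> exists d, m (1 - c * d)].

Lemma bigcup_ideal (C : set (set R)) : C !=set0 -> total_on C subset ->
  (forall I, C I -> is_ideal I) -> is_ideal (\bigcup_(I in C) I).
Proof.
move=> [I0 CI0] totC hC; split.
- by exists I0 => //; apply: ideal_0; apply: hC.
- move=> x y [I CI Ix] [J CJ Jy]; have [IJ|JI] := totC _ _ CI CJ.
    by exists J => //; apply: idealD; [exact: hC|exact: IJ|].
  by exists I => //; apply: idealD; [exact: hC| |exact: JI].
- by move=> a x [I CI Ix]; exists I => //; apply: ideal_mull => //; apply: hC.
Qed.

(* The quotient L / N0 is a vector space over the residue field, in which N / N0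
   has a complement. *)
Lemma ideal_complement n (N0 N L : set R) :
    residually_field n -> is_ideal N0 -> is_ideal N -> is_ideal L ->
    N0 `<=` N -> N `<=` L -> (forall u g, n u -> L g -> N0 (u * g)) ->
  exists J, [/\ is_ideal J, J `<=` L, N0 `<=` J,
    (forall x, J x -> N x -> N0 x) &
    (forall x, L x -> exists j y, [/\ J j, N y & x = j + y])].
Proof.
move=> [hn n1 nfield] hN0 hN hL N0N NL nL.
pose P J := [/\ is_ideal J, J `<=` L, N0 `<=` J & forall x, J x -> N x -> N0 x].
have [||J [[hJ JL N0J JN] Jmax]] := @maximal_of_chains R P.
- by exists N0; split=> //; exact: subset_trans NL.
- move=> C C0 CP totC; split.
  + by apply: bigcup_ideal => // I /CP[].
  + by move=> x [I /CP[_ IL _ _]] Ix; exact: IL.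
  + case: C0 => I CI x N0x; exists I => //; case: (CP _ CI) => _ _ N0I _; exact: N0I.
  + by move=> x [I /CP[_ _ _ IN0]] Ix; exact: IN0.
exists J; split=> // x Lx.
pose J' := ideal_add J (ideal_gen [set x]).
have hJ' : is_ideal J' by apply: is_ideal_add => //; exact: is_ideal_gen.
have JJ' : J `<=` J' by apply: ideal_addl; exact: is_ideal_gen.
have J'x : J' x by apply: ideal_addr => //; exact: ideal_gen_sub.
have [hP|hP] := pselect (forall y, J' y -> N y -> N0 y).
  have J'J : J' = J.
    apply: Jmax => //; split=> //; last exact: subset_trans JJ'.
    by apply: ideal_add_sub => //; apply: ideal_gen_min => // _ ->.
  exists x, 0; split; [by rewrite -J'J|exact: ideal_0|by rewrite addr0].
have [y [J'y Ny N0y]] : exists y, [/\ J' y, N y & ~ N0 y].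
  apply: contrapT => h; apply: hP => y J'y Ny.
  by apply: contrapT => N0y; apply: h; exists y.
case: J'y => j Jj [z]; rewrite ideal_gen1 => -[a _ <-] yE.
(* If a were in n, then a * x would lie in N0 and y in J. Hence a has an inverse d modulo n, and y =
   j + a * x can be solved for x modulo N0. *)
have na : ~ n a.
  move=> na; apply/N0y/JN => //; rewrite -yE; apply: idealD => //.
  by apply: N0J; apply: nL.
have [d hd] := nfield _ na.
exists (- (d * j) + (1 - a * d) * x), (d * y); split.
- apply: idealD => //; first by apply: idealN => //; apply: ideal_mull.
  by apply/N0J/nL.
- exact: ideal_mull.
- rewrite -yE mulrBl mul1r mulrDr.
  by rewrite mulrA [a * d]mulrC addrACA addNr add0r subrK.
Qed.

End IdealTheory.

(** * Symmetric forms and squares of ideals in polynomial rings *)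

Lemma is_ideal_preimage (A B : comNzRingType) (f : {rmorphism A -> B}) (I : set B) :
  is_ideal I -> is_ideal (f @^-1` I).
Proof.
move=> hI; split=> [|x y fx fy|a x fx] /=.
- by rewrite rmorph0; apply: ideal_0.
- by rewrite rmorphD; apply: idealD.
- by rewrite rmorphM; apply: ideal_mull.
Qed.

(** The elements killed by m form a vector space over the residue field, on which c acts as a
    nonzero scalar. *)
Lemma residually_field_cancel (R : comNzRingType) (m : set R) (c v : R) :
  residually_field m -> ~ m c -> (forall a, m a -> a * v = 0) -> c * v = 0 -> v = 0.
Proof.
move=> [_ _ hm] /hm[d md] /(_ _ md) + cv0.
by rewrite mulrBl mul1r mulrAC cv0 mul0r subr0.
Qed.

Lemma residually_field_prime (R : comNzRingType) (m : set R) (a b : R) :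
  residually_field m -> m (a * b) -> ~ m a -> m b.
Proof.
move=> [hm _ mfield] mab /mfield[d md]; rewrite -[b]mul1r -(subrK (a * d) 1).
rewrite mulrDl mulrAC; apply: idealD => //; exact: ideal_mulr.
Qed.

Lemma residually_field_primeX (R : comNzRingType) (m : set R) (a : R) n :
  residually_field m -> ~ m a -> ~ m (a ^+ n).
Proof.
move=> hm ma; elim: n => [|n IHn]; first by case: hm.
by rewrite exprS => /(residually_field_prime hm)/(_ ma).
Qed.

Section PolySet.
Variables (A : comNzRingType).
Implicit Types (I : set A).

Definition poly_set I : set {poly A} := [set p | forall j, I p`_j].

Lemma is_ideal_poly_set I : is_ideal I -> is_ideal (poly_set I).
Proof.
move=> hI; split=> [j|p q hp hq j|a p hp j].
- by rewrite coef0; apply: ideal_0.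
- by rewrite coefD; apply: idealD.
- by rewrite coefM; apply: ideal_sum => // k _; apply: ideal_mull.
Qed.

Lemma poly_set_mul I : is_ideal I ->
  ideal_mul (poly_set I) (poly_set I) = poly_set (ideal_mul I I).
Proof.
move=> hI; have hIp := is_ideal_poly_set hI.
have hII : is_ideal (ideal_mul I I) by exact: is_ideal_mul.
apply/seteqP; split=> [|p hp].
  apply: ideal_mul_min; first exact: is_ideal_poly_set.
  move=> p q hp hq j; rewrite coefM; apply: ideal_sum => // k _.
  by apply: ideal_mul_sub; [exact: hp|exact: hq].
rewrite -[p]coefK poly_def; apply: ideal_sum => [|i _]; first exact: is_ideal_mul.
have /(ideal_mulP _ _ hI)[s hs ->] := hp i.
rewrite -mul_polyC rmorph_sum /= mulr_suml.
apply: ideal_sum => [|t /hs[t1 t2]]; first exact: is_ideal_mul.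
rewrite polyCM -mulrA; apply: ideal_mul_sub => j.
  by rewrite coefC; case: eqP => // _; apply: ideal_0.
rewrite coefCM; exact: ideal_mulr.
Qed.

(* Gauss' lemma away from the leading coefficient of f. *)
Lemma poly_set_cancel I (f E : {poly A}) : is_ideal I ->
  poly_set I (E * f) -> exists N, poly_set I (lead_coef f ^+ N *: E).
Proof.
move=> hI; have hIp := is_ideal_poly_set hI.
move: {2}(size E) (leqnn (size E)) => n; elim: n E => [|n IHn] E sE IEf.
  exists 0; rewrite leqn0 size_poly_eq0 in sE; rewrite (eqP sE) scaler0.
  exact: ideal_0.
pose e := lead_coef E; pose c := lead_coef f.
have [E0|E0] := eqVneq E 0; first by exists 0; rewrite E0 scaler0; apply: ideal_0.
(* The top coefficient of E * f is c * e, zero or not, so T has coefficients in I; c *: E - T has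
   lower degree and its product with f still has coefficients in I. *)
pose T := (c * e) *: 'X^((size E).-1).
have IT : poly_set I T.
  move=> j; rewrite coefZ; apply: ideal_mulr => //.
  by rewrite mulrC mul_lead_coef; apply: IEf.
pose E1 := c *: E - T.
have sE1 : (size E1 <= n)%N.
  apply/leq_sizeP => j nj; rewrite coefB !coefZ coefXn.
  have [-> |jE] := eqVneq j (size E).-1; first by rewrite mulr1 subrr.
  rewrite mulr0 subr0 nth_default ?mulr0 // leqNgt.
  apply: contra_neqN jE => jsE; suff -> : size E = j.+1 by [].
  by apply/eqP; rewrite eqn_leq jsE andbT (leq_trans sE).
have [|N IN] := IHn E1 sE1.
  rewrite mulrBl -scalerAl; apply: (idealB hIp) => //.
    by rewrite -mul_polyC; apply: (ideal_mull _ hIp).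
  exact: (ideal_mulr _ hIp).
exists N.+1; rewrite exprSr -scalerA -(subrK T (c *: E)) scalerDr.
by apply: (idealD hIp) => //; rewrite -mul_polyC; apply: (ideal_mull _ hIp).
Qed.

End PolySet.

Section SymmetricForms.
Variables (R : comNzRingType) (m : set R) (w : R -> R).
Hypothesis hm : residually_field m.
Hypothesis w_sym : forall u v, m u -> m v -> w u * v = w v * u.
Hypothesis w_sq : forall u v v', m u -> m v -> m v' -> w u * (v * v') = 0.

(* The symmetric form (u, v) |-> w u * v on the kernel n of A -> R / m induces a
   map on n ^ 2. *)
Definition induces_on_square (A : comNzRingType) (phi : {rmorphism A -> R}) :=
  forall s : seq (A * A), pairs_in (phi @^-1` m) (phi @^-1` m) s ->
    \sum_(p <- s) p.1 * p.2 = 0 -> \sum_(p <- s) w (phi p.1) * phi p.2 = 0.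

Let m_ideal : is_ideal m. Proof. by case: hm. Qed.

(** [w] is an arbitrary function, not a linear one: symmetry moves u to the factor in which the form
    is visibly linear. Additivity follows in the same way. *)
Lemma symmetric_scale a u v : m u -> m v -> w (a * u) * v = a * (w u * v).
Proof.
move=> mu mv; rewrite (@w_sym (a * u) v) //; last exact: ideal_mull.
by rewrite mulrCA (w_sym mv mu).
Qed.

Let w_add u u' v : m u -> m u' -> m v -> w (u + u') * v = w u * v + w u' * v.
Proof.
move=> mu mu' mv; rewrite (@w_sym (u + u') v) //; last exact: idealD.
by rewrite mulrDr (w_sym mv mu) (w_sym mv mu').
Qed.

Let form_cancel c v : ~ m c -> (forall a, m a -> a * v = 0) -> c * v = 0 -> v = 0.
Proof. exact: residually_field_cancel. Qed.

(** The preimage of m is generated by one integer q. Dividing a relation by q ^ 2 leaves a vanishing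
    sum of products of cofactors, and the form on the relation is the image of that sum times
    [w q * q]. *)
Lemma int_induces_on_square (phi : {rmorphism int -> R}) : induces_on_square phi.
Proof.
move=> s hs s0; have hP := is_ideal_preimage phi m_ideal.
have [allz|] := pselect (forall z, m (phi z) -> z = 0).
  rewrite big_seq big1 // => p /hs[_ /allz ->].
  by rewrite rmorph0 mulr0.
move=> /existsNP[z /not_implyP[mz /eqP z0]].
have : exists n : nat, (0 < n)%N && `[< m (phi n%:Z) >].
  exists `|z|%N; rewrite absz_gt0 z0; apply/asboolP.
  by rewrite abszEsign; apply: (ideal_mull _ hP).
case/ex_minnP => q /andP[q0 /asboolP mq] qmin.
have dvd_q x : m (phi x) -> x = (x %/ q%:Z)%Z * q%:Z.
  move=> mx; rewrite {1}(divz_eq x q%:Z).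
  suff -> : (x %% q%:Z)%Z = 0 by rewrite addr0.
  have mr : m (phi (x %% q%:Z)%Z).
    apply: (idealB hP) => //; exact: (ideal_mull _ hP).
  have /(ltz_pmod x) : 0 < q%:Z by [].
  have : 0 <= (x %% q%:Z)%Z by apply: modz_ge0; rewrite -lt0n.
  move: mr; case: (x %% q%:Z)%Z => // r mr _ rq; congr Posz; apply/eqP.
  rewrite -leqn0 leqNgt; apply/negP => r0.
  have := qmin r; rewrite r0 (asboolT mr) => /(_ isT).
  by rewrite leqNgt -ltz_nat rq.
have /eqP : (\sum_(p <- s) (p.1 %/ q%:Z)%Z * (p.2 %/ q%:Z)%Z) * q%:Z ^+ 2 = 0.
  rewrite -[RHS]s0 mulr_suml big_seq [RHS]big_seq; apply: eq_bigr => p /hs[p1 p2].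
  by rewrite {2}(dvd_q _ p1) {2}(dvd_q _ p2) mulrACA.
rewrite mulf_eq0 expf_eq0 /= -[q%:Z == 0]/(q == 0%N) -leqn0 leqNgt q0 orbF => /eqP ds.
suff -> : \sum_(p <- s) w (phi p.1) * phi p.2 =
   phi (\sum_(p <- s) (p.1 %/ q%:Z)%Z * (p.2 %/ q%:Z)%Z) * (w (phi q%:Z) * phi q%:Z).
  by rewrite ds rmorph0 mul0r.
rewrite rmorph_sum mulr_suml big_seq [RHS]big_seq; apply: eq_bigr => p /hs[p1 p2].
rewrite {1}(dvd_q _ p1) {1}(dvd_q _ p2) !rmorphM symmetric_scale //; last exact: ideal_mull.
by rewrite -[RHS]mulrA; congr (_ * _); exact: mulrCA.
Qed.

Section Polynomials.
Variables (A : comNzRingType) (phi : {rmorphism A -> R}).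
Variable Phi : {rmorphism {poly A} -> R}.
Hypothesis PhiC : forall a, Phi a%:P = phi a.
Hypothesis phi_square : induces_on_square phi.

Let q := phi @^-1` m.
Let P := Phi @^-1` m.
Let q_ideal : is_ideal q. Proof. exact: is_ideal_preimage. Qed.
Let P_ideal : is_ideal P. Proof. exact: is_ideal_preimage. Qed.

Let PhiE p : Phi p = \sum_(j < size p) phi p`_j * Phi 'X ^+ j.
Proof.
rewrite -{1}[p]coefK poly_def rmorph_sum; apply: eq_bigr => j _ /=.
by rewrite -mul_polyC rmorphM rmorphXn PhiC.
Qed.

Let Phi_poly_set p : poly_set q p -> m (Phi p).
Proof.
move=> qp; rewrite PhiE; apply: ideal_sum => // j _; apply: ideal_mulr => //.
exact: qp.
Qed.

Let w0 v : m v -> w 0 * v = 0.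
Proof. by move=> mv; rewrite w_sym ?mulr0 //; exact: ideal_0. Qed.

Let extended_square s : pairs_in (poly_set q) (poly_set q) s ->
  \sum_(p <- s) p.1 * p.2 = 0 -> \sum_(p <- s) w (Phi p.1) * Phi p.2 = 0.
Proof.
move=> hs s0.
(* The coefficient of X^d in the relation is itself a relation over A, so [phi_square] kills each
   coefficient of the sum of V. Evaluation at the image of X then gives the claim; w sits on the
   coefficients of [p.2] so that symmetry can turn it into [w (Phi p.1)]. *)
pose V (p : {poly A} * {poly A}) : {poly R} :=
  (\poly_(j < size p.2) w (phi p.2`_j)) * \poly_(j < size p.1) phi p.1`_j.
have V0 : \sum_(p <- s) V p = 0.
  apply/polyP => d; rewrite coef0 coef_sum.
  pose t := [seq ((p.2 : {poly A})`_j, (p.1 : {poly A})`_(d - j)) | p <- s, j <- iota 0 d.+1].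
  rewrite -[RHS](phi_square (s := t)); first last.
  - rewrite /t big_allpairs_dep /=.
    rewrite -[LHS]/(\sum_(p <- s) \sum_(j <- iota 0 d.+1) p.2`_j * p.1`_(d - j)).
    rewrite -[RHS](coef0 _ d) -[in RHS]s0 coef_sum; apply: eq_bigr => p _.
    by rewrite mulrC coefM -[iota _ _]/(index_iota 0 d.+1) big_mkord.
  - by move=> _ /allpairsP[[p j] /= [/hs[p1 p2] _ ->]]; split; [apply: p2|apply: p1].
  rewrite big_allpairs_dep big_seq [RHS]big_seq; apply: eq_bigr => p /hs[p1 p2].
  rewrite coefM -[iota _ _]/(index_iota 0 d.+1) big_mkord; apply: eq_bigr => j _ /=.
  (* Past the size of [p.2] the polynomial has coefficient 0 while the pair from t contributes
     [w 0]. This need not be 0, but it annihilates m by [w0]. *)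
  rewrite !coef_poly; case: ltnP => j2; case: ltnP => dj1 //.
  - by rewrite (nth_default _ dj1) rmorph0.
  - rewrite mul0r (nth_default _ j2) rmorph0 w0 //; exact: p1.
  - by rewrite mul0r (nth_default _ j2) (nth_default _ dj1) rmorph0 mulr0.
have <- : (\sum_(p <- s) V p).[Phi 'X] = \sum_(p <- s) w (Phi p.1) * Phi p.2.
  rewrite horner_sum big_seq [RHS]big_seq; apply: eq_bigr => p /hs[p1 p2].
  rewrite hornerM !horner_poly -PhiE (PhiE p.2) mulr_suml mulr_sumr.
  apply: eq_bigr => j _; rewrite mulrAC (w_sym (p2 j)) ?mulrA //.
  exact: Phi_poly_set.
by rewrite V0 horner0.
Qed.

Let square_Phi0 (f E : {poly A}) : m (Phi f) ->
  poly_set (ideal_mul q q) E -> w (Phi f) * Phi E = 0.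
Proof.
move=> mf; rewrite -poly_set_mul //.
suff: ideal_mul (poly_set q) (poly_set q) `<=` [set E | w (Phi f) * Phi E = 0].
  by apply.
apply: ideal_mul_min => [|p1 p2 /Phi_poly_set m1 /Phi_poly_set m2].
  split=> [|a b /= ha hb|a b /= hb] /=; first by rewrite rmorph0 mulr0.
    by rewrite rmorphD mulrDr ha hb addr0.
  by rewrite rmorphM mulrCA hb mulr0.
by rewrite /= rmorphM w_sq.
Qed.

(* If P is strictly larger than the extension of q, let f be an element of P of least
   degree outside that extension.  Pseudo-division by f turns the relation into
   G f^2 + H f + W = 0 with G, H in q[X] and W in q^2[X], and cancelling f in
   (G f + H) f = - W shows that the terms in H and W do not contribute. *)
Lemma poly_induces_on_square : induces_on_square Phi.
Proof.
move=> s hs s0.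
have [allq|] := pselect (forall p, P p -> poly_set q p).
  by apply: extended_square => // p /hs[p1 p2]; split; apply: allq.
move=> /existsNP[f0 /not_implyP[Pf0 qf0]].
have [f [Pf qf fmin]] : exists f : {poly A}, [/\ P f, ~ poly_set q f &
    forall g : {poly A}, P g -> (size g < size f)%N -> poly_set q g].
  have : exists n, `[< exists g : {poly A}, [/\ P g, ~ poly_set q g & size g = n] >].
    by exists (size f0); apply/asboolP; exists f0.
  case/ex_minnP => n /asboolP[f [Pf qf <-]] nmin; exists f; split=> // g Pg gf.
  apply: contrapT => qg; move: gf; rewrite ltnNge => /negP; apply; apply: nmin.
  by apply/asboolP; exists g.
pose c := lead_coef f.
have f_neq0 : f != 0 by apply: contra_not_neq qf => -> j; rewrite coef0; apply: ideal_0.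
(* Otherwise removing the leading term, which lies in q[X], leaves an element of P of lower degree,
   and minimality would put f in q[X]. *)
have qc : ~ q c.
  move=> qc; apply: qf; pose l : {poly A} := c *: 'X^((size f).-1).
  have ql : poly_set q l by move=> j; rewrite coefZ; apply: ideal_mulr.
  rewrite -(subrK l f); apply: (idealD (is_ideal_poly_set q_ideal)) => //.
  apply: fmin; first by apply: idealB => //; apply: Phi_poly_set.
  rewrite -(prednK (n := size f)) ?size_poly_gt0 // ltnS; apply/leq_sizeP => j jf.
  rewrite coefB coefZ coefXn; have [->|jf'] := eqVneq j (size f).-1.
    by rewrite mulr1 subrr.
  rewrite mulr0 subr0 nth_default // -(prednK (n := size f)) ?size_poly_gt0 //.
  by rewrite ltn_neqAle eq_sym jf'.
have mc n : ~ m (phi (c ^+ n)).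
  by rewrite rmorphXn; apply: residually_field_primeX.
(* Pseudo-division multiplies each u by its own power of c; N is a common exponent for all entries
   of s. *)
pose N := \max_(p <- s) maxn (Pdiv.Ring.rscalp p.1 f) (Pdiv.Ring.rscalp p.2 f).
pose g (u : {poly A}) : {poly A} := c ^+ (N - Pdiv.Ring.rscalp u f) *: Pdiv.Ring.rdivp u f.
pose r (u : {poly A}) : {poly A} := c ^+ (N - Pdiv.Ring.rscalp u f) *: Pdiv.Ring.rmodp u f.
have grE u : (Pdiv.Ring.rscalp u f <= N)%N -> c ^+ N *: u = g u * f + r u.
  move=> uN; rewrite -{1}(subnK uN) exprD -scalerA Pdiv.ComRing.rdivp_eq.
  by rewrite scalerDr scalerAl.
have {}grE p : p \in s ->
    c ^+ N *: p.1 = g p.1 * f + r p.1 /\ c ^+ N *: p.2 = g p.2 * f + r p.2.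
  move=> ps; have : (maxn (Pdiv.Ring.rscalp p.1 f) (Pdiv.Ring.rscalp p.2 f) <= N)%N.
    exact: (@leq_bigmax_seq _ _ _ (fun p : {poly A} * {poly A} =>
      maxn (Pdiv.Ring.rscalp p.1 f) (Pdiv.Ring.rscalp p.2 f)) p ps isT).
  by rewrite geq_max => /andP[/grE ? /grE].
have qr u : P u -> c ^+ N *: u = g u * f + r u -> poly_set q (r u).
  move=> Pu uE; apply: fmin; last first.
    by apply: leq_ltn_trans (size_scale_leq _ _) _; rewrite Pdiv.Ring.ltn_rmodp.
  rewrite -[r u](addKr (g u * f)) addrC -uE; apply: idealB => //.
    by rewrite -mul_polyC; apply: ideal_mull.
  exact: ideal_mull.
pose G := \sum_(p <- s) g p.1 * g p.2.
pose H := \sum_(p <- s) (g p.1 * r p.2 + g p.2 * r p.1).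
pose W := \sum_(p <- s) r p.1 * r p.2.
have GHW : G * f * f + H * f + W = 0.
  rewrite /G /H /W !mulr_suml -!big_split /=.
  transitivity (c ^+ N *: (c ^+ N *: \sum_(p <- s) p.1 * p.2)); last by rewrite s0 !scaler0.
  rewrite 2!scaler_sumr big_seq [RHS]big_seq; apply: eq_bigr => p /grE[p1 p2].
  rewrite [c ^+ N *: (p.1 * _)]scalerAl scalerAr p1 p2; ring.
have qr1 p : p \in s -> poly_set q (r p.1) /\ poly_set q (r p.2).
  by move=> ps; have [p1 p2] := grE _ ps; have [P1 P2] := hs _ ps; split; apply: qr.
have qX := is_ideal_poly_set q_ideal.
have hqq : is_ideal (ideal_mul q q) by exact: is_ideal_mul.
have qqX := is_ideal_poly_set hqq.
have cancel_f E : poly_set q (E * f) -> poly_set q E.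
  move=> /(poly_set_cancel q_ideal)[M qM] j; have := qM j; rewrite coefZ /q /= rmorphM.
  by move=> /(residually_field_prime hm); apply; apply: mc.
have qH : poly_set q H.
  apply: ideal_sum => // p /qr1[r1 r2].
  by apply: (idealD qX); apply: (ideal_mull _ qX).
have qW : poly_set (ideal_mul q q) W.
  rewrite -poly_set_mul //; apply: ideal_sum => [|p /qr1[r1 r2]]; first exact: is_ideal_mul.
  exact: ideal_mul_sub.
(* The quotients g need not lie in q[X], but modulo q[X] the relation reads G * f * f = 0. Since q
   is prime and c is outside it, f cancels twice. *)
have qG : poly_set q G.
  apply/cancel_f/cancel_f; have -> : G * f * f = - (H * f + W).
    by apply/eqP; rewrite -addr_eq0 addrA GHW.
  apply: (idealN qX); apply: (idealD qX); first exact: (ideal_mulr _ qX).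
  move=> j; have := qW j; apply: ideal_mul_min => // x y qx _; exact: ideal_mulr.
pose E := G * f + H.
have [M qqE] : exists M, poly_set (ideal_mul q q) (c ^+ M *: E).
  apply: poly_set_cancel => //.
  have -> : E * f = - W by apply/eqP; rewrite -addr_eq0 mulrDl GHW.
  exact: (idealN qqX).
have mw a u v : m u -> m v -> m a -> a * (w u * v) = 0.
  by move=> mu mv ma; rewrite mulrCA w_sq.
have mr p : p \in s -> m (Phi (r p.1)) /\ m (Phi (r p.2)).
  by move=> /qr1[/Phi_poly_set r1 /Phi_poly_set r2].
have WE : \sum_(p <- s) w (Phi (r p.1)) * Phi (r p.2) = 0.
  apply: (form_cancel (mc M)) => [a ma|].
    rewrite mulr_sumr big_seq big1 // => p /mr[r1 r2]; exact: mw.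
  move: (qqE); rewrite -poly_set_mul // => /(ideal_mulP _ _ qX)[t ht tE].
  (* With c^M * E written as a sum of products t1 * t2 from q[X], the pairs (c^M * r1, r2) and (t1,
     t2 * f) form a relation in q[X], because E * f + W = 0. The second family has form 0, as t2 and
     f both map into m. *)
  have := @extended_square ([seq (c ^+ M *: r p.1, r p.2) | p <- s] ++
                            [seq (p.1, p.2 * f) | p <- t]).
  rewrite !big_cat !big_map /=.
  have -> : \sum_(p <- t) w (Phi p.1) * Phi (p.2 * f) = 0.
    rewrite big_seq big1 // => p /ht[/Phi_poly_set t1 /Phi_poly_set t2].
    by rewrite rmorphM w_sq.
  have -> : \sum_(p <- s) w (Phi (c ^+ M *: r p.1)) * Phi (r p.2) =
      phi (c ^+ M) * \sum_(p <- s) w (Phi (r p.1)) * Phi (r p.2).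
    rewrite mulr_sumr big_seq [RHS]big_seq; apply: eq_bigr => p /mr[r1 r2].
    by rewrite -mul_polyC rmorphM PhiC symmetric_scale.
  rewrite addr0; apply.
    apply: pairs_in_cat => x /mapP[p ps ->] /=.
      by have [r1 r2] := qr1 _ ps; split=> //; rewrite -mul_polyC; apply: (ideal_mull _ qX).
    by have [t1 t2] := ht _ ps; split=> //; apply: (ideal_mulr _ qX).
  have -> : \sum_(p <- t) p.1 * (p.2 * f) = (c ^+ M *: E) * f.
    by rewrite tE mulr_suml; apply: eq_bigr => p _; rewrite mulrA.
  under eq_bigr do rewrite -scalerAl.
  by rewrite -scaler_sumr -scalerAl -scalerDr addrC mulrDl GHW scaler0.
have fE : w (Phi f) * Phi E = 0.
  apply: (form_cancel (mc M)) => [a ma|].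
    by apply: mw => //; apply: Phi_poly_set; apply: (idealD qX) => //; apply: (ideal_mulr _ qX).
  by rewrite mulrCA -PhiC -rmorphM mul_polyC; apply: square_Phi0.
have fH : w (Phi f) * Phi H = 0.
  have -> : H = E - G * f by rewrite addrC addKr.
  by rewrite rmorphB rmorphM mulrBr fE w_sq ?subr0 //; apply: Phi_poly_set.
have s_kill a : m a -> a * \sum_(p <- s) w (Phi p.1) * Phi p.2 = 0.
  by move=> ma; rewrite mulr_sumr big_seq big1 // => p /hs[p1 p2]; exact: mw.
(* Both entries of each pair are multiplied by c^N, so this factor has to be cancelled twice. *)
apply: (form_cancel (mc N) s_kill); apply: (form_cancel (mc N)) => [a /s_kill h|].
  by rewrite mulrCA h mulr0.
transitivity (Phi G * (w (Phi f) * Phi f) + w (Phi f) * Phi H +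
   \sum_(p <- s) w (Phi (r p.1)) * Phi (r p.2)); last first.
  by rewrite WE fH !addr0; apply: mw => //; apply: Phi_poly_set.
rewrite !rmorph_sum !mulr_suml !mulr_sumr -!big_split /= big_seq [RHS]big_seq.
apply: eq_bigr => p ps; have [p1 p2] := grE _ ps; have [r1 r2] := mr _ ps.
have [s1 s2] := hs _ ps.
have mgf u : m (Phi (g u) * Phi f) by apply: ideal_mull.
transitivity (w (Phi (c ^+ N *: p.1)) * Phi (c ^+ N *: p.2)).
  rewrite -!mul_polyC !rmorphM !PhiC symmetric_scale //; last exact: ideal_mull.
  by congr (_ * _); exact: mulrCA.
rewrite p1 p2 !rmorphD !rmorphM w_add //; last exact: idealD.
rewrite symmetric_scale //; last exact: idealD.
rewrite !mulrDr !(mulrCA _ (Phi _) (Phi f)) (w_sym r1 Pf).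
ring.
Qed.

End Polynomials.

End SymmetricForms.

(** * A cover on which every symmetric form extends *)

(* The families (x s) in the product of the A s whose images in R are eventually constant
   along the finite sequences s of elements of R, ordered by inclusion.  This replaces a
   polynomial ring on all elements of R. *)
Section EventuallyConstant.
Variables (R : comNzRingType) (A : seq R -> comNzRingType).
Variable phi : forall s, {rmorphism A s -> R}.

Definition family := forall s, A s.

HB.instance Definition _ := Choice.on family.

Fact family_addA : associative (fun (x y : family) s => x s + y s : A s).
Proof. by move=> x y z; apply: functional_extensionality_dep => s; rewrite addrA. Qed.
Fact family_addC : commutative (fun (x y : family) s => x s + y s : A s).
Proof. by move=> x y; apply: functional_extensionality_dep => s; rewrite addrC. Qed.
Fact family_add0 : left_id (fun s => 0 : A s) (fun (x y : family) s => x s + y s : A s).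
Proof. by move=> x; apply: functional_extensionality_dep => s; rewrite add0r. Qed.
Fact family_addN : left_inverse (fun s => 0 : A s) (fun (x : family) s => - x s : A s)
  (fun (x y : family) s => x s + y s : A s).
Proof. by move=> x; apply: functional_extensionality_dep => s; rewrite addNr. Qed.

HB.instance Definition _ :=
  GRing.isZmodule.Build family family_addA family_addC family_add0 family_addN.

Fact family_mulA : associative (fun (x y : family) s => x s * y s : A s).
Proof. by move=> x y z; apply: functional_extensionality_dep => s; rewrite mulrA. Qed.
Fact family_mulC : commutative (fun (x y : family) s => x s * y s : A s).
Proof. by move=> x y; apply: functional_extensionality_dep => s; rewrite mulrC. Qed.
Fact family_mul1 : left_id (fun s => 1 : A s) (fun (x y : family) s => x s * y s : A s).
Proof. by move=> x; apply: functional_extensionality_dep => s; rewrite mul1r. Qed.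
Fact family_mulD :
  left_distributive (fun (x y : family) s => x s * y s : A s) +%R.
Proof. by move=> x y z; apply: functional_extensionality_dep => s; exact: mulrDl. Qed.
Fact family_1_neq0 : (fun s => 1 : A s) != 0 :> family.
Proof. by apply/eqP => /(congr1 (fun x : family => x [::]))/eqP; rewrite oner_eq0. Qed.

HB.instance Definition _ := GRing.Zmodule_isComNzRing.Build family
  family_mulA family_mulC family_mul1 family_mulD family_1_neq0.

Definition tends_to (x : family) (r : R) :=
  exists s0 : seq R, forall s, {subset s0 <= s} -> phi s (x s) = r.

Lemma tends_to_uniq x r r' : tends_to x r -> tends_to x r' -> r = r'.
Proof.
move=> [s hs] [s' hs']; rewrite -(hs (s ++ s')) ?(hs' (s ++ s')) // => y ys;
  by rewrite mem_cat ys ?orbT.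
Qed.

Lemma tends_to2 (op : forall S : comNzRingType, S -> S -> S) x y r r' :
    (forall s, {morph phi s : a b / op _ a b >-> op _ a b}) ->
  tends_to x r -> tends_to y r' -> tends_to (fun s => op _ (x s) (y s)) (op _ r r').
Proof.
move=> phi_op [s hs] [s' hs']; exists (s ++ s') => t st.
by rewrite phi_op hs ?hs' // => z zs; apply: st; rewrite mem_cat zs ?orbT.
Qed.

Definition convergent : {pred family} := fun x => `[< exists r, tends_to x r >].

Fact convergent_subring : subring_closed convergent.
Proof.
split=> [|x y /asboolP[r xr] /asboolP[r' yr']|x y /asboolP[r xr] /asboolP[r' yr']].
- by apply/asboolP; exists 1, [::] => s _; rewrite rmorph1.
- apply/asboolP; exists (r - r').
  apply: (tends_to2 (op := fun S a b => a - b)) => // s a b.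
  exact: rmorphB.
- apply/asboolP; exists (r * r').
  apply: (tends_to2 (op := fun S a b => a * b)) => // s a b.
  exact: rmorphM.
Qed.

HB.instance Definition _ :=
  GRing.isSubringClosed.Build family convergent convergent_subring.

Record convergent_family :=
  ConvergentFamily { family_val :> family; _ : family_val \in convergent }.

HB.instance Definition _ := [isSub for family_val].
HB.instance Definition _ := [Choice of convergent_family by <:].
HB.instance Definition _ := [SubChoice_isSubComNzRing of convergent_family by <:].

Fact family_limit_subproof (x : convergent_family) : exists r, tends_to x r.
Proof. by case: x => x /= /asboolP. Qed.

Definition family_limit x := sval (cid (family_limit_subproof x)).

Lemma family_limitP (x : convergent_family) : tends_to x (family_limit x).
Proof. exact: svalP (cid (family_limit_subproof x)). Qed.

Lemma family_limitE (x : convergent_family) r : tends_to x r -> family_limit x = r.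
Proof. exact/tends_to_uniq/family_limitP. Qed.

Fact family_limit_zmod_morphism : zmod_morphism family_limit.
Proof.
move=> x y; apply: family_limitE.
apply: (tends_to2 (op := fun S a b => a - b)); [|exact: family_limitP..].
by move=> s a b; exact: rmorphB.
Qed.

Fact family_limit_monoid_morphism : monoid_morphism family_limit.
Proof.
split; first by apply: family_limitE; exists [::] => s _; rewrite rmorph1.
move=> x y; apply: family_limitE.
apply: (tends_to2 (op := fun S a b => a * b)); [|exact: family_limitP..].
by move=> s a b; exact: rmorphM.
Qed.

HB.instance Definition _ :=
  GRing.isZmodMorphism.Build convergent_family R family_limit family_limit_zmod_morphism.
HB.instance Definition _ :=
  GRing.isMonoidMorphism.Build convergent_family R family_limit family_limit_monoid_morphism.

Lemma family_limit_surj : (forall s r, r \in s -> exists a, phi s a = r) ->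
  forall r, exists x, family_limit x = r.
Proof.
move=> phi_surj r.
have x s : {a : A s | r \in s -> phi s a = r}.
  apply: cid; have [/phi_surj[a <-]|_] := boolP (r \in s); first by exists a.
  by exists 0.
have xr : tends_to (fun s => sval (x s)) r.
  by exists [:: r] => s rs; apply: (svalP (x s)); apply: rs; rewrite mem_head.
have xc : (fun s => sval (x s)) \in convergent by apply/asboolP; exists r.
by exists (ConvergentFamily xc); apply: family_limitE.
Qed.

(** A relation involves finitely many families, so one index s is large enough for all of them to
    have reached their limits, and the relation can be read in [A s]. *)
Lemma family_limit_square (m : set R) (w : R -> R) :
  (forall s, induces_on_square m w (phi s)) ->
  induces_on_square m w family_limit.
Proof.
move=> phi_sq t ht t0.
have [s hs] : exists s, forall p, p \in t ->
    phi s (family_val p.1 s) = family_limit p.1 /\ phi s (family_val p.2 s) = family_limit p.2.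
  suff [s0 hs0] : exists s0 : seq R, forall s, {subset s0 <= s} -> forall p, p \in t ->
    phi s (family_val p.1 s) = family_limit p.1 /\ phi s (family_val p.2 s) = family_limit p.2.
    by exists s0; apply: hs0.
  elim: {ht t0} t => [|p t [s0 hs0]]; first by exists [::].
  have [s1 hs1] := family_limitP p.1; have [s2 hs2] := family_limitP p.2.
  exists (s0 ++ s1 ++ s2) => s sub p'; rewrite inE => /predU1P[->|p't].
    by split; [apply: hs1|apply: hs2] => x xs; apply: sub; rewrite !mem_cat xs ?orbT.
  by apply: hs0 => // x xs; apply: sub; rewrite !mem_cat xs.
have := phi_sq s [seq (family_val p.1 s, family_val p.2 s) | p <- t].
rewrite !big_map /= => h.
transitivity (\sum_(p <- t) w (phi s (family_val p.1 s)) * phi s (family_val p.2 s)).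
  by rewrite big_seq [RHS]big_seq; apply: eq_bigr => p /hs[-> ->].
apply: h.
  by move=> _ /mapP[p pt ->] /=; have [/= -> ->] := hs _ pt; exact: ht.
transitivity (family_val (\sum_(p <- t) p.1 * p.2) s); last by rewrite t0.
elim/big_rec2: _ => // p x y _ ->; by [].
Qed.

End EventuallyConstant.

(** For each finite s the ring is an iterated polynomial ring over the integers, one variable for
    each entry of s. These rings are chosen independently, with no maps between them, so they are
    glued by eventually constant families rather than by a colimit. *)
Lemma exists_square_cover (R : comNzRingType) (m : set R) (w : R -> R) :
    residually_field m ->
    (forall u v, m u -> m v -> w u * v = w v * u) ->
    (forall u v v', m u -> m v -> m v' -> w u * (v * v') = 0) ->
  exists (F : comNzRingType) (pi : {rmorphism F -> R}),
    (forall r, exists x, pi x = r) /\ induces_on_square m w pi.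
Proof.
move=> hm w_sym w_sq.
have cover (s : seq R) : {A : comNzRingType & {phi : {rmorphism A -> R} |
    induces_on_square m w phi /\ forall r, r \in s -> exists a, phi a = r}}.
  suff /cid[A /cid[phi hphi]] : exists (A : comNzRingType) (phi : {rmorphism A -> R}),
    induces_on_square m w phi /\ forall r, r \in s -> exists a, phi a = r.
    by exists A, phi.
  elim: s => [|r s [A [phi [phi_sq phi_s]]]].
    by exists int; exists intr; split=> //; apply: int_induces_on_square.
  pose Phi : {rmorphism {poly A} -> R} := horner_eval r \o map_poly phi.
  have PhiC a : Phi a%:P = phi a by rewrite /= map_polyC /horner_eval hornerC.
  exists {poly A}; exists Phi; split; first exact: (poly_induces_on_square hm w_sym w_sq PhiC).
  move=> r'; rewrite inE => /predU1P[->|/phi_s[a <-]]; last by exists a%:P.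
  by exists 'X; rewrite /= map_polyX /horner_eval hornerX.
pose A s := projT1 (cover s); pose phi s : {rmorphism A s -> R} := sval (projT2 (cover s)).
exists (convergent_family phi), (@family_limit _ _ phi); split.
  by apply: family_limit_surj => s; case: (svalP (projT2 (cover s))).
by apply: family_limit_square => s; case: (svalP (projT2 (cover s))).
Qed.

(** * Chains of ideals and double annihilators *)

Lemma noetherian_maximal (R : comNzRingType) (P : set (set R)) :
    noetherian R -> (exists I, P I) -> (forall I, P I -> is_ideal I) ->
  exists M, P M /\ forall I, P I -> M `<=` I -> I = M.
Proof.
move=> hR exP Pideal; apply: maximal_of_chains => // C [X0 CX0] CP totC.
have CU X : C X -> X `<=` \bigcup_(Y in C) Y by move=> CX x Xx; exists X.
have [|s sE] := hR (\bigcup_(X in C) X).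
  apply: bigcup_ideal => //; first by exists X0.
  by move=> I /CP/Pideal.
have [X [CX sX]] : exists X, C X /\ [set` s] `<=` X.
  have : [set` s] `<=` \bigcup_(X in C) X by rewrite sE; apply: ideal_gen_sub.
  elim: {sE} s => [|x s IHs] sC; first by exists X0; split=> // x; rewrite /= in_nil.
  have [|X [CX sX]] := IHs; first by move=> y ys; apply: sC; rewrite /= inE ys orbT.
  have [Y CY Yx] : (\bigcup_(X in C) X) x by apply: sC; rewrite /= inE eqxx.
  have [XY|YX] := totC _ _ CX CY.
    by exists Y; split=> // z /=; rewrite inE => /predU1P[-> //|zs]; apply/XY/sX.
  by exists X; split=> // z /=; rewrite inE => /predU1P[->|zs]; [exact: YX|exact: sX].
suff -> : \bigcup_(Y in C) Y = X by exact: CP.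
apply/seteqP; split; last exact: CU.
by rewrite sE; apply: ideal_gen_min => //; apply/Pideal/CP.
Qed.

Section Chains.
Variables (R : comNzRingType) (m : set R).
Implicit Types I J K : set R.

(* J / I is zero or a line over the residue field. *)
Definition simple_step I J :=
  [/\ I `<=` J, forall a x, m a -> J x -> I (a * x) &
      forall x y, J x -> J y -> ~ I x -> exists a, I (y - a * x)].

(** Annihilators, images and preimages of a strict chain need not be strict, so a chain without the
    flag may repeat an ideal. *)
Inductive chain (strict : bool) I : nat -> set R -> Prop :=
| Chain0 : is_ideal I -> chain strict I 0 I
| ChainS n J J' of chain strict I n J & is_ideal J' & simple_step J J'
    & (strict -> ~ J' `<=` J) : chain strict I n.+1 J'.

Lemma chain_ideal b I n J : chain b I n J -> is_ideal J.
Proof. by case. Qed.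

Lemma chain_cat b I n J p K : chain b I n J -> chain b J p K -> chain b I (n + p) K.
Proof.
move=> IJ; elim=> [_|p' K' K'' _ IH hK'' step strict]; first by rewrite addn0.
by rewrite addnS; apply: ChainS IH _ _ _.
Qed.

Inductive height_ge : nat -> set R -> Prop :=
| Height0 I : is_ideal I -> height_ge 0 I
| HeightS n I J of height_ge n I & is_ideal J & I `<=` J & ~ J `<=` I :
    height_ge n.+1 J.

Lemma chain_height I n J : chain true I n J -> height_ge n J.
Proof.
elim=> [|n' J1 J2 _ h hJ2 [J12 _ _] strict]; first exact: Height0.
by apply: HeightS h _ _ _ => //; apply: strict.
Qed.

Lemma height_geW n I J : height_ge n I -> is_ideal J -> I `<=` J -> height_ge n J.
Proof.
case=> [I' _ hJ _|n' I' I'' h _ I'I'' nI'' hJ IJ]; first exact: Height0.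
apply: HeightS h _ _ _ => //; first exact: subset_trans IJ.
by move=> JI'; apply: nI''; apply: subset_trans JI'.
Qed.

(** Intersecting with A costs at most one strict inclusion. If C is not inside A, some x0 of C
    outside A reduces every y of I' into A modulo C; so if I' and C had the same intersection with
    A, I' would lie in C. *)
Lemma height_ge_step n I A B : is_ideal A -> simple_step A B ->
  height_ge n.+1 I -> I `<=` B -> height_ge n (I `&` A).
Proof.
move=> hA [AB _ step]; move Ek: n.+1 => k h.
elim: h n Ek => [//|n' C I' hC IH hI' CI' nI'C] n [n'E] I'B.
have hIA := is_idealI hI' hA.
have [CA|/existsNP[x0 /not_implyP[Cx0 nAx0]]] := pselect (C `<=` A).
  rewrite n'E; apply: height_geW hC _ _ => // x Cx; split; [exact: CI'|exact: CA].
case: n n'E => [_|n n'E]; first exact: Height0.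
apply: (HeightS (IH n n'E (subset_trans CI' I'B))) => //; first exact: setSI.
move=> sub; apply: nI'C => y I'y.
have hC' : is_ideal C by case: hC.
have [a Aa] := step x0 y (I'B _ (CI' _ Cx0)) (I'B _ I'y) nAx0.
apply: (idealB_cancel (y := a * x0)) => //; first exact: ideal_mull.
apply: (sub _ _).1; split=> //; apply: idealB => //; apply: ideal_mull => //.
exact: CI'.
Qed.

(** The inequality half of the Jordan-Hoelder theorem: simple steps, even with repetitions, bound
    the length of every strict chain below. *)
Lemma height_ge_chain b n A l I : chain b [set 0] n A -> height_ge l I -> I `<=` A ->
  (l <= n)%N.
Proof.
move=> hA; elim: hA l I => [_|{}n J J' hJ IH hJ' step _] l I hI sub.
  case: hI sub => // l' C I' hC _ CI' nI'C I'0; case: nI'C => x /I'0 ->.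
  by apply: ideal_0; case: hC.
case: l hI => // l hI; rewrite ltnS; apply: (IH l (I `&` J)); last exact: subIsetr.
exact: height_ge_step (chain_ideal hJ) step hI sub.
Qed.

Lemma chain_finitely_generated b n J I : chain b [set 0] n J -> is_ideal I -> I `<=` J ->
  exists s : seq R, I = ideal_gen [set` s].
Proof.
move=> hJ; elim: hJ I => [_|{}n J' J'' hJ' IH hJ'' [J'J'' _ step] _] I hI sub.
  exists [::]; apply/seteqP; split=> [x /sub ->|].
    exact: (ideal_0 (is_ideal_gen _)).
  by apply: ideal_gen_min => // x; rewrite /= in_nil.
have [//|/existsNP[x /not_implyP[Ix nJ'x]]] := pselect (I `<=` J'); first exact: IH.
have [||s sE] := IH (I `&` J'); first exact/is_idealI/(chain_ideal hJ').
  exact: subIsetr.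
exists (x :: s); apply/seteqP; split=> [y Iy|].
  have hg : is_ideal (ideal_gen [set` x :: s]) by exact: is_ideal_gen.
  have [a J'a] := step x y (sub _ Ix) (sub _ Iy) nJ'x.
  apply: (idealB_cancel hg (y := a * x)).
    by apply: (ideal_mull _ hg); apply: ideal_gen_sub; rewrite /= mem_head.
  have : (I `&` J') (y - a * x) by split=> //; apply: idealB => //; apply: ideal_mull.
  rewrite sE; apply: (ideal_gen_min hg) => z zs; apply: ideal_gen_sub.
  by rewrite /= inE zs orbT.
apply: ideal_gen_min => // y /=; rewrite inE => /orP[/eqP -> //|ys].
have : (I `&` J') y by rewrite sE; apply: ideal_gen_sub.
by case.
Qed.

Lemma chain_noetherian b n : chain b [set 0] n setT -> noetherian R.
Proof. by move=> h I hI; apply: chain_finitely_generated h hI _. Qed.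

Lemma chain_artinian b n : chain b [set 0] n setT -> artinian R.
Proof.
move=> h I hI Idec.
have Ile j k : (j <= k)%N -> I k `<=` I j.
  elim: k => [|k IHk]; first by rewrite leqn0 => /eqP ->.
  rewrite leq_eqVlt => /predU1P[-> //|/IHk]; exact: subset_trans.
have : exists N, forall n, (N <= n)%N -> I n `<=` setT by exists 0.
elim: h I hI {Idec} Ile => [_|{}n J J' hJ IH hJ' [JJ' _ step] _] I hI Ile [N0 sub].
  exists N0 => k Nk; apply/seteqP; split; first exact: Ile.
  by move=> x /(sub _ (leqnn _)) ->; apply: ideal_0.
(* If the sequence never enters J, each member contains an element outside J, hence fills the line
   J' / J; the members then coincide as soon as their intersections with J do. *)
have [|noJ] := pselect (exists N, forall n, (N <= n)%N -> I n `<=` J).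
  exact: IH.
have [|||N hN] := IH (fun k => I k `&` J).
- by move=> k; apply/is_idealI/(chain_ideal hJ).
- by move=> j k jk x [Ix Jx]; split=> //; apply: Ile jk _ _.
- by exists 0 => k _; apply: subIsetr.
exists (maxn N N0) => k; rewrite geq_max => /andP[Nk N0k].
apply/seteqP; split; first by apply: Ile; rewrite geq_max Nk.
move=> y Iy.
have [x [Ix nJx]] : exists x, I k x /\ ~ J x.
  apply: contrapT => h; apply: noJ; exists k => j kj x Ijx.
  by apply: contrapT => nJx; apply: h; exists x; split=> //; apply: Ile kj _ _.
have Ixm : I (maxn N N0) x by apply: Ile Ix; rewrite geq_max Nk.
have [a Ja] := step x y (sub _ N0k _ Ix) (sub _ (leq_maxr _ _) _ Iy) nJx.
apply: (idealB_cancel (y := a * x)) => //; first exact: ideal_mull.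
have : (I (maxn N N0) `&` J) (y - a * x).
  by split=> //; apply: idealB => //; apply: ideal_mull.
by rewrite hN ?leq_maxl // -(hN _ Nk) => -[].
Qed.

End Chains.

(** * Duality of ideals and their annihilators *)

Section DoubleAnnihilator.
Variables (R : comNzRingType) (m : set R) (N : nat).
Hypothesis hm : residually_field m.
Hypothesis m_nilp : ideal_exp m N = [set 0].
Implicit Types I J K : set R.

Let m_ideal : is_ideal m. Proof. by case: hm. Qed.

(** Otherwise m^(n+1) x inside I forces m^n x inside I for x in J; descending from m^N = 0 puts J
    inside I. *)
Lemma relative_socle I J : is_ideal I -> is_ideal J -> ~ J `<=` I ->
  exists x, [/\ J x, ~ I x & forall a, m a -> I (a * x)].
Proof.
move=> hI hJ nJI; apply: contrapT => h; apply: nJI.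
have {}h x : J x -> (forall a, m a -> I (a * x)) -> I x.
  by move=> Jx mx; apply: contrapT => nIx; apply: h; exists x.
suff nilp n x : J x -> (forall a, ideal_exp m n a -> I (a * x)) -> I x.
  move=> x Jx; apply: (nilp N) => // a; rewrite m_nilp /= => ->; rewrite mul0r.
  exact: ideal_0.
elim: n x => [|n IHn] x Jx hx; first by rewrite -[x]mul1r; apply: hx.
apply: IHn => // b mb; apply: h; first exact: ideal_mull.
by move=> a ma; rewrite mulrA; apply: hx; apply: ideal_mul_sub.
Qed.

Lemma simple_step_adjoin I x : is_ideal I -> (forall a, m a -> I (a * x)) ->
  simple_step m I (ideal_add I (ideal_gen [set x])).
Proof.
move=> hI mx; split; first exact/ideal_addl/is_ideal_gen.
  move=> a z ma [i Ii [y]]; rewrite ideal_gen1 => -[b _ <-] <-.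
  rewrite mulrDr mulrCA; apply: idealD => //; apply: ideal_mull => //; exact: mx.
have [_ _ mfield] := hm.
move=> z z' [i Ii [y]]; rewrite {1}ideal_gen1 => -[b _ <-] <-.
move=> [j Ij [y']]; rewrite ideal_gen1 => -[c _ <-] <- nIx.
have mb : ~ m b.
  by move=> mb; apply: nIx; apply: idealD => //; apply: mx.
have [d md] := mfield _ mb; exists (c * d).
have -> : j + c * x - c * d * (i + b * x) = j - c * d * i + c * ((1 - b * d) * x).
  by ring.
by apply: idealD => //; [apply: idealB => //|]; apply: ideal_mull => //; apply: mx.
Qed.

Lemma chain_exists I J : noetherian R -> is_ideal I -> is_ideal J -> I `<=` J ->
  exists n, chain m true I n J.
Proof.
move=> hR hI hJ IJ.
have [||M [[MJ [n cM]] Mmax]] :=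
  @noetherian_maximal R [set K | K `<=` J /\ exists n, chain m true I n K] hR.
- by exists I; split=> //; exists 0; apply: Chain0.
- by move=> K [_ [n /chain_ideal]].
have hM := chain_ideal cM.
have [JM|nJM] := pselect (J `<=` M).
  by exists n; suff -> : J = M by []; apply/seteqP.
have [x [Jx nMx mx]] := relative_socle hM hJ nJM; case: nMx.
pose M' := ideal_add M (ideal_gen [set x]).
have M'x : M' x by apply: ideal_addr => //; apply: ideal_gen_sub.
have [|] := pselect (M' `<=` M); first by apply.
move=> nM'M; suff <- : M' = M by [].
apply: Mmax; last exact/ideal_addl/is_ideal_gen.
split; first by apply: ideal_add_sub => //; apply: ideal_gen_min => // _ ->.
exists n.+1; apply: ChainS cM _ _ _ => //; first exact/is_ideal_add/is_ideal_gen.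
exact: simple_step_adjoin.
Qed.

Variable d : R.
Hypothesis hd : socle_generator m d.

Let socleP x : (forall a, m a -> x * a = 0) -> exists u, x = u * d.
Proof.
move=> hx; have : ann m x by [].
by case: hd => _ ->; rewrite ideal_gen1 => -[u _ <-]; exists u.
Qed.

Let socle_d a : m a -> a * d = 0.
Proof.
have : ann m d by case: hd => _ ->; apply: ideal_gen_sub.
by move=> + ma => /(_ _ ma); rewrite mulrC.
Qed.

(** Multiplication pairs ann I / ann J with J / I, with values in the socle line, and only 0 on the
    left pairs to zero. So ann I / ann J is at most a line when J / I is. *)
Lemma ann_simple_step I J : is_ideal I -> is_ideal J -> simple_step m I J ->
  simple_step m (ann J) (ann I).
Proof.
move=> hI hJ [IJ mJI step]; have [_ _ mfield] := hm.
split; first exact: annS.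
  by move=> a x ma Ix y Jy; rewrite mulrAC mulrC Ix //; apply: mJI.
move=> x x' Ix Ix' /existsNP[y /not_implyP[Jy /eqP xy0]].
have nIy : ~ I y by move=> /Ix /eqP; apply/negP.
have [u xyE] : exists u, x * y = u * d.
  by apply: socleP => a ma; rewrite -mulrA Ix // mulrC; apply: mJI.
have [u' x'yE] : exists u', x' * y = u' * d.
  by apply: socleP => a ma; rewrite -mulrA Ix' // mulrC; apply: mJI.
have mu : ~ m u by move=> mu; move: xy0; rewrite xyE socle_d // eqxx.
have [e me] := mfield _ mu; exists (u' * e) => y' Jy'.
have [b Ib] := step y y' Jy Jy' nIy.
have -> : (x' - u' * e * x) * y' =
  x' * (y' - b * y) - u' * e * (x * (y' - b * y)) + b * (x' * y - u' * e * (x * y)).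
  by ring.
rewrite (Ix _ Ib) (Ix' _ Ib) mulr0 subr0 add0r x'yE xyE.
have -> : u' * d - u' * e * (u * d) = u' * ((1 - u * e) * d) by ring.
by rewrite socle_d ?mulr0.
Qed.

Lemma ann_chain b I n J : chain m b I n J -> chain m false (ann J) n (ann I).
Proof.
elim=> [hI|{}n K K' cK IH hK' step _]; first exact/Chain0/is_ideal_ann.
rewrite -[n.+1]add1n; apply: chain_cat IH.
apply: ChainS (Chain0 _ _ (is_ideal_ann _)) (is_ideal_ann _) _ _ => //.
exact: ann_simple_step (chain_ideal cK) hK' step.
Qed.

(* Otherwise I and J = (0 : (0 : I)) have the same annihilator; the annihilators of a
   strict chain from 0 to R through I and J then give a chain with simple steps from 0 to R
   that is shorter than the strict one. *)
Lemma double_ann I : noetherian R -> is_ideal I -> ann (ann I) = I.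
Proof.
move=> hR hI; set J := ann (ann I).
have IJ : I `<=` J by move=> x Ix y; rewrite mulrC; apply.
have hJ : is_ideal J by exact: is_ideal_ann.
have annJ : ann J = ann I.
  apply/seteqP; split; first exact: annS.
  by move=> x Ix y; rewrite mulrC; apply.
apply: contrapT => JI.
have zeroI : [set 0] `<=` I by move=> _ ->; apply: ideal_0.
have [i ci] := chain_exists hR (is_ideal_set0 R) hI zeroI.
have [k ck] := chain_exists hR hI hJ IJ.
have [l cl] := chain_exists hR hJ (is_idealT R) (fun x _ => Logic.I).
have height : height_ge (i + k + l) [set: R].
  exact: (chain_height (chain_cat (chain_cat ci ck) cl)).
have ann0 : ann [set 0] = [set: R].
  by apply/seteqP; split=> // x _ y ->; rewrite mulr0.
have annT : ann [set: R] = [set 0].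
  apply/seteqP; split=> [x /(_ 1 Logic.I)|x -> y _]; rewrite ?mulr1 ?mul0r //.
have := ann_chain cl; rewrite annJ annT => cl'.
have := chain_cat cl' (ann_chain ci); rewrite ann0 => weak.
have := height_ge_chain weak height (@subset_refl _ _).
rewrite addnAC [(l + i)%N]addnC -{2}[(i + l)%N]addn0 leq_add2l leqn0 => /eqP k0.
by apply: JI; move: ck; rewrite k0 => ck; inversion ck.
Qed.

End DoubleAnnihilator.

(** * Preimages, images and sums of chains *)

Section ChainTransfer.
Variables (A B : comNzRingType) (f : {rmorphism A -> B}).
Hypothesis f_surj : forall y, exists x, f x = y.

Lemma is_ideal_image I : is_ideal I -> is_ideal (f @` I).
Proof.
move=> hI; split.
- by exists 0; [apply: ideal_0|rewrite rmorph0].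
- by move=> _ _ [x Ix <-] [y Iy <-]; exists (x + y); [apply: idealD|rewrite rmorphD].
- move=> b _ [x Ix <-]; have [a <-] := f_surj b.
  by exists (a * x); [apply: ideal_mull|rewrite rmorphM].
Qed.

Lemma chain_preimage m b I n J : chain m b I n J ->
  chain (f @^-1` m) false (f @^-1` I) n (f @^-1` J).
Proof.
elim=> [hI|{}n K K' cK IH hK' [KK' mK step] _]; first exact/Chain0/is_ideal_preimage.
apply: ChainS IH _ _ _ => //; first exact: is_ideal_preimage.
split=> [x /KK' //|a x ma Kx|x y Kx Ky nKx].
  by rewrite /= rmorphM; apply: mK.
have [c Kc] := step _ _ Kx Ky nKx; have [a fa] := f_surj c.
by exists a; rewrite /= rmorphB rmorphM fa.
Qed.

Lemma chain_image m b I n J : chain m b I n J ->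
  chain (f @` m) false (f @` I) n (f @` J).
Proof.
elim=> [hI|{}n K K' cK IH hK' [KK' mK step] _]; first exact/Chain0/is_ideal_image.
apply: ChainS IH _ _ _ => //; first exact: is_ideal_image.
split=> [_ [x /KK' Kx <-]|_ _ [a ma <-] [x Kx <-]|_ _ [x Kx <-] [y Ky <-] nKx].
- by exists x.
- by rewrite -rmorphM; exists (a * x) => //; apply: mK.
- have [|a Ka] := step _ _ Kx Ky; first by move=> Kx'; apply: nKx; exists x.
  by exists (f a); exists (y - a * x) => //; rewrite rmorphB rmorphM.
Qed.

Lemma ideal_exp_image m n : f @` (ideal_exp m n) = ideal_exp (f @` m) n.
Proof.
elim: n => [|n IHn].
  by apply/seteqP; split=> // y _; have [x <-] := f_surj y; exists x.
apply/seteqP; split.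
  have hp : is_ideal (f @^-1` (ideal_exp (f @` m) n.+1)).
    by apply: is_ideal_preimage; apply: is_ideal_exp.
  move=> _ [x mx <-]; move: x mx; apply: (ideal_mul_min hp) => x y mx my.
  have fy : ideal_exp (f @` m) n (f y) by rewrite -IHn; exists y.
  by rewrite /= rmorphM; apply: ideal_mul_sub => //; exists x.
apply: ideal_mul_min; first by apply: is_ideal_image; apply: is_ideal_exp.
move=> _ y' [x mx <-] my'; have : ideal_exp (f @` m) n y' by [].
rewrite -IHn => -[y my <-].
by exists (x * y); [apply: ideal_mul_sub|rewrite rmorphM].
Qed.

End ChainTransfer.

Lemma chain_add (R : comNzRingType) (m : set R) b I n J K :
  is_ideal K -> chain m b I n J -> chain m false (ideal_add K I) n (ideal_add K J).
Proof.
move=> hK; elim=> [hI|{}n J1 J2 cJ IH hJ2 [J12 mJ step] _]; first exact/Chain0/is_ideal_add.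
have hJ1 := chain_ideal cJ.
apply: ChainS IH _ _ _ => //; first exact: is_ideal_add.
split.
- by move=> _ [x Kx [y Jy <-]]; exists x => //; exists y => //; apply: J12.
- move=> a _ ma [x Kx [y Jy <-]]; exists (a * x); first exact: ideal_mull.
  by exists (a * y); [apply: mJ|rewrite mulrDr].
- move=> _ _ [x Kx [y Jy <-]] [x' Kx' [y' Jy' <-]] nKJ.
  have [|a Ja] := step y y' Jy Jy'.
    by move=> J1y; apply: nKJ; exists x => //; exists y.
  exists a, (x' - a * x); first by apply: idealB => //; apply: ideal_mull.
  by exists (y' - a * y) => //; ring.
Qed.

(** * Quotients and local rings *)

Section BundledIdeal.
Variables (A : comNzRingType) (J : set A).
Hypotheses (hJ : is_ideal J) (J1 : ~ J 1).

Definition ideal_pred : {pred A} := fun x => `[< J x >].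

Fact ideal_pred_closed : idealr_closed ideal_pred.
Proof.
split; first by apply/asboolP; apply: ideal_0.
- by apply/negP => /asboolP.
- by move=> a x y /asboolP Jx /asboolP Jy; apply/asboolP; apply: idealD => //; apply: ideal_mull.
Qed.

HB.instance Definition _ := isIdealr.Build A ideal_pred ideal_pred_closed.

Definition bundled_ideal : idealr A := ideal_pred.

End BundledIdeal.

Lemma bundled_idealE (A : comNzRingType) (J : set A) (hJ : is_ideal J) (J1 : ~ J 1) :
  [set x | x \in bundled_ideal hJ J1] = J.
Proof. by apply/seteqP; split=> x /asboolP. Qed.


Section IdealQuotient.
Local Open Scope quotient_scope.
Variables (A : comNzRingType) (I : idealr A).

Definition quotient_map : {rmorphism A -> {ideal_quot I}} := \pi_{ideal_quot I}.

Lemma quotient_map_eq0 (x : A) : quotient_map x = 0 <-> x \in I.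
Proof.
rewrite -[in X in _ <-> X](subr0 x) Quotient.idealrBE; split=> [x0|/eqP x0].
  by apply/eqP; apply: etrans x0 _; rewrite -(rmorph0 quotient_map).
by apply: etrans x0 _; exact: (rmorph0 quotient_map).
Qed.

Lemma quotient_map_surj y : exists x, quotient_map x = y.
Proof. by exists (repr y); exact: reprK. Qed.

End IdealQuotient.

Lemma quotient_exists (A : comNzRingType) (J : set A) : is_ideal J -> ~ J 1 ->
  exists (Q : comNzRingType) (q : {rmorphism A -> Q}),
    (forall y, exists x, q x = y) /\ (forall x, q x = 0 <-> J x).
Proof.
move=> hJ J1; exists {ideal_quot (bundled_ideal hJ J1)}, (quotient_map _).
split=> [|x]; first exact: quotient_map_surj.
rewrite quotient_map_eq0; split=> [xJ|Jx].
  by move: xJ; rewrite /in_mem /= => /asboolP.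
exact/asboolP.
Qed.

Lemma rmorphism_factor (A B C : comNzRingType) (f : {rmorphism A -> B})
    (g : {rmorphism A -> C}) : (forall y, exists x, f x = y) ->
    (forall x, f x = 0 -> g x = 0) ->
  exists h : {rmorphism B -> C}, forall x, h (f x) = g x.
Proof.
move=> f_surj fg; have [s sK] := choice f_surj.
have hE x : g (s (f x)) = g x.
  by apply/eqP; rewrite -subr_eq0 -rmorphB fg // rmorphB sK subrr.
pose h y := g (s y).
have h_zmod : zmod_morphism h.
  move=> y z; rewrite /h -rmorphB -[RHS]hE rmorphB !sK; by [].
have h_monoid : monoid_morphism h.
  split; first by rewrite /h -(rmorph1 f) hE rmorph1.
  by move=> y z; rewrite /h -rmorphM -[RHS]hE rmorphM !sK.
pose m1 := GRing.isZmodMorphism.Build B C h h_zmod.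
pose m2 := GRing.isMonoidMorphism.Build B C h h_monoid.
pose h' : {rmorphism B -> C} := HB.pack h m1 m2.
by exists h'; exact: hE.
Qed.

Lemma residue_field_exists (A : comNzRingType) (n : set A) : residually_field n ->
  exists (k : fieldType) (p : {rmorphism A -> k}),
    (forall c, exists x, p x = c) /\ (forall x, p x = 0 <-> n x).
Proof.
move=> [hn n1 nfield].
have [Q [q [q_surj qE]]] := quotient_exists hn n1.
have /choice[i iP] : forall x : Q, exists y, (x != 0 -> y * x = 1) /\ (x = 0 -> y = 0).
  move=> x; have [->|x0] := eqVneq x 0; first by exists 0.
  have [a ax] := q_surj x; have na : ~ n a by rewrite -qE ax; apply/eqP.
  have [d /qE nd] := nfield _ na; exists (q d); split=> // [_|x0']; last by rewrite x0' eqxx in x0.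
  apply/eqP; rewrite eq_sym -subr_eq0 -ax mulrC -rmorphM -(rmorph1 q) -rmorphB.
  exact/eqP.
pose fm := GRing.ComNzRing_isField.Build Q (fun x => (iP x).1) ((iP 0).2 erefl).
pose k : fieldType := HB.pack Q fm.
by exists k, q.
Qed.

Lemma local_unit (A : comNzRingType) (m : set A) : is_local m ->
  forall x, ~ m x -> exists y, x * y = 1.
Proof.
move=> hm x mx; apply: contrapT => nx.
pose P (I : set A) := [/\ is_ideal I, ~ I 1 & I x].
have [||M [[hM M1 Mx] Mmax]] := @maximal_of_chains A P.
- exists (ideal_gen [set x]); split; [exact: is_ideal_gen| |exact: ideal_gen_sub].
  by rewrite ideal_gen1 => -[a _ ax]; apply: nx; exists a; rewrite mulrC.
- move=> C [X CX] CP totC; split.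
  + by apply: bigcup_ideal; [exists X| |move=> I /CP[]].
  + by move=> [I /CP[_ + _]].
  + by exists X => //; case: (CP _ CX).
suff : maximal_ideal M by move=> /hm ME; apply: mx; rewrite -ME.
split=> // J hJ MJ; have [J1|J1] := pselect (J 1).
  by right; apply/seteqP; split=> // y _; rewrite -[y]mulr1; apply: ideal_mull.
by left; apply: Mmax => //; split=> //; exact: MJ.
Qed.

Lemma local_residually_field (A : comNzRingType) (m : set A) :
  is_local m -> residually_field m.
Proof.
move=> hm; have [hmi m1 _] : maximal_ideal m by exact/hm.
split=> // c /(local_unit hm)[d cd]; exists d; rewrite cd subrr; exact: ideal_0.
Qed.

Lemma ideal_exp_pow (A : comNzRingType) (m : set A) x n : m x -> ideal_exp m n (x ^+ n).
Proof.
move=> mx; elim: n => [|n IHn]; first exact: Logic.I.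
rewrite exprS; apply: ideal_mul_sub; [exact: mx|exact: IHn].
Qed.

Lemma nilpotent_local (A : comNzRingType) (m : set A) N :
  residually_field m -> ideal_exp m N = [set 0] -> is_local m.
Proof.
move=> [hm m1 mfield] mN.
have mmax : maximal_ideal m.
  split=> // J hJ mJ; have [Jm|/existsNP[x /not_implyP[Jx nmx]]] := pselect (J `<=` m).
    by left; apply/seteqP.
  have [d md] := mfield _ nmx; right; apply/seteqP; split=> // y _.
  rewrite -[y]mulr1 -(subrK (x * d) 1); apply: ideal_mull => //.
  by apply: idealD => //; [exact: mJ|exact: ideal_mulr].
move=> n; split=> [[hn n1 nmax]|-> //].
suff mn : m `<=` n by case: mmax => _ _ /(_ n hn mn)[|nT] //; case: n1; rewrite nT.
move=> x mx; apply: contrapT => nx; apply: n1.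
have [||nE|nT] := nmax (ideal_add n (ideal_gen [set x])).
- exact/is_ideal_add/is_ideal_gen.
- exact/ideal_addl/is_ideal_gen.
- by case: nx; rewrite -nE; apply: ideal_addr => //; apply: ideal_gen_sub.
have : ideal_add n (ideal_gen [set x]) 1 by rewrite nT.
move=> [a na [y]]; rewrite ideal_gen1 => -[b _ <-] abx.
have bxN : (b * x) ^+ N = 0.
  have : ideal_exp m N ((b * x) ^+ N) by apply: ideal_exp_pow; apply: ideal_mull.
  by rewrite mN.
(* 1 = 1 - (b * x) ^ N is a multiple of 1 - b * x = a, which lies in n. *)
rewrite -[1]subr0 -bxN -opprB subrX1 -mulNr opprB; apply: ideal_mulr => //.
by rewrite -abx addrK.
Qed.

Lemma loewy_lengthE (A : comNzRingType) (m : set A) l :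
  ideal_exp m l <> [set 0] -> ideal_exp m l.+1 = [set 0] -> loewy_length m = l.
Proof.
move=> ml ml1.
have lP k : ideal_exp m k <> [set 0] -> (k <= l)%N.
  move=> mk; rewrite leqNgt; apply/negP => lk; apply: mk.
  apply/seteqP; split=> [|_ ->]; last by apply: ideal_0; exact: is_ideal_exp.
  by rewrite -ml1; apply: ideal_exp_le.
apply: xget_unique => // j [mj jP].
by apply/eqP; rewrite eqn_leq lP // jP.
Qed.

(** The default of [xget] is 0, so a positive value certifies that the maximum exists. *)
Lemma loewy_lengthP (A : comNzRingType) (m : set A) : (0 < loewy_length m)%N ->
  ideal_exp m (loewy_length m) <> [set 0] /\ ideal_exp m (loewy_length m).+1 = [set 0].
Proof.
rewrite /loewy_length; case: xgetP => // l _ [ml lP] _; split=> //.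
by apply: contrapT => /lP; rewrite ltnn.
Qed.

(** m^l is killed by m, so a nonzero element of it is u * d with u outside m, and inverting u modulo
    m recovers d. *)
Lemma socle_sub_loewy (A : comNzRingType) (m : set A) l d : residually_field m ->
    socle_generator m d -> ideal_exp m l <> [set 0] -> ideal_exp m l.+1 = [set 0] ->
  ideal_exp m l d.
Proof.
move=> [hm m1 mfield] [d0 dE] ml ml1.
have [x [mx x0]] : exists x, ideal_exp m l x /\ x <> 0.
  apply: contrapT => h; apply: ml; apply/seteqP; split=> [x mx|_ ->].
    by apply: contrapT => x0; apply: h; exists x.
  by apply: ideal_0; exact: is_ideal_exp.
have mann y : ideal_exp m l y -> ann m y.
  move=> my a ma; have : ideal_exp m l.+1 (a * y) by apply: ideal_mul_sub.
  by rewrite ml1 mulrC.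
have md a : m a -> a * d = 0.
  have : ann m d by rewrite dE; apply: ideal_gen_sub.
  by move=> + ma => /(_ _ ma); rewrite mulrC.
have := mann _ mx; rewrite dE ideal_gen1 => -[u _ ux].
have mu : ~ m u by move=> /md ud; apply: x0; rewrite -ux.
have [e me] := mfield _ mu.
have -> : d = e * x + (1 - u * e) * d by rewrite -ux; ring.
by rewrite md // addr0; apply: ideal_mull mx; exact: is_ideal_exp.
Qed.

(** * Gorenstein quotients *)

Lemma socle_mul0 (R : comNzRingType) (m : set R) d a :
  socle_generator m d -> m a -> a * d = 0.
Proof.
move=> [_ dE] ma; have : ann m d by rewrite dE; apply: ideal_gen_sub.
by move=> /(_ _ ma); rewrite mulrC.
Qed.

Lemma socle_multiple (R : comNzRingType) (m : set R) d x :
  socle_generator m d -> ann m x -> exists c, x = c * d.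
Proof. by move=> [_ ->]; rewrite ideal_gen1 => -[c _ <-]; exists c. Qed.

Lemma socle_unit (R : comNzRingType) (m : set R) d a : residually_field m ->
  socle_generator m d -> a * d = 0 -> m a.
Proof.
move=> hm hd ad0; apply: contrapT => ma; case: (hd) => d0 _; apply: d0.
apply: (residually_field_cancel hm ma) => // b; exact: socle_mul0.
Qed.

Section SocleComplement.
Variables (R : comNzRingType) (m : set R) (d : R) (l : nat).
Hypotheses (hm : residually_field m) (hR : noetherian R).
Hypotheses (hd : socle_generator m d) (l2 : (2 <= l)%N).
Hypotheses (mld : ideal_exp m l d) (ml1 : ideal_exp m l.+1 = [set 0]).

Lemma socle_complement : ~ (ann (ideal_exp m 2) `<=` ideal_exp m 2) ->
  exists W : set R, [/\ is_ideal W, W `<=` ann (ideal_exp m 2), ann m `<=` W,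
    (forall x, W x -> ann W x -> ann m x) &
    (forall u, m u -> exists2 w, W w & ann W (u - w)) /\
    exists w u, [/\ W w, m u & w * u = d]].
Proof.
have [hmi _ mfield] := hm.
move=> /existsNP[y0 /not_implyP[ann_y0 ny0]].
set M := ideal_exp m 2; have hM : is_ideal M by exact: is_ideal_exp.
have Md : M d by apply: ideal_exp_le mld.
have annmM : ann m `<=` M.
  by move=> x /(socle_multiple hd)[c ->]; apply: (ideal_mull _ hM).
have annm_annM : ann m `<=` ann M.
  by apply: annS; rewrite /M ideal_exp2 //; apply: ideal_mul_min => // x y mx _; apply: ideal_mulr.
have [|||W [hW WM mW WN splitW]] := @ideal_complement R m (ann m) (ann M `&` M) (ann M)
    hm (is_ideal_ann _) (is_idealI (is_ideal_ann _) hM) (is_ideal_ann _).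
- by move=> x mx; split; [exact: annm_annM|exact: annmM].
- exact: subIsetl.
- move=> u g mu Mg a ma; rewrite mulrAC mulrC Mg // mulrC.
  exact: ideal_exp2_sub.
(* x kills W by assumption and kills M because W lies in ann M. As ann M is the sum of W and its
   part in M, x lies in ann (ann M) = M, and W meets M only in the socle. *)
have WZ x : W x -> ann W x -> ann m x.
  move=> Wx Zx; apply: WN => //; split; first exact: WM.
  have <- : ann (ann M) = M by apply: (double_ann hm ml1 hd).
  move=> g /splitW[w [nu [Ww [Mnu Mnu'] ->]]].
  by rewrite mulrDr Zx // WM ?addr0.
exists W; split=> //; split.
  (* ann I lies in both ann W and ann (ann W) = W, hence in ann m; taking annihilators again gives m
     inside I. *)
  pose I := ideal_add W (ann W).
  have hI : is_ideal I by apply: is_ideal_add => //; exact: is_ideal_ann.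
  suff mI : m `<=` I.
    move=> u /mI[w Ww [z Zz <-]]; exists w => //.
    by rewrite addrC addKr.
  rewrite -(double_ann hm ml1 hd hR hI) => u mu x Ix; rewrite mulrC.
  suff mx : ann m x by exact: mx.
  apply: WZ; last by apply: annS Ix; apply: ideal_addl; exact: is_ideal_ann.
  rewrite -(double_ann hm ml1 hd hR hW).
  by apply: annS Ix; apply: ideal_addr.
(* If W were killed by m, it would lie in M, and so would y0, which is a sum of an element of W and
   one of M. *)
have [w [u [Ww mu wu0]]] : exists w u, [/\ W w, m u & w * u <> 0].
  apply: contrapT => h; apply: ny0.
  have [w [nu [Ww [_ Mnu] ->]]] := splitW _ ann_y0.
  apply: (idealD hM) => //; apply: annmM => u mu.
  by apply: contrapT => wu; apply: h; exists w, u.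
have [c wuE] : exists c, w * u = c * d.
  apply: (socle_multiple hd) => a ma; rewrite -mulrA WM //.
  exact: ideal_exp2_sub.
have mc : ~ m c by move=> mc; apply: wu0; rewrite wuE (socle_mul0 hd).
have [e me] := mfield _ mc; exists (e * w), u; split=> //; first exact: ideal_mull.
rewrite -mulrA wuE; have -> : e * (c * d) = d - (1 - c * e) * d by ring.
by rewrite (socle_mul0 hd) // subr0.
Qed.

End SocleComplement.

Section GorensteinQuotient.
Variables (R F Q : comNzRingType) (pi : {rmorphism F -> R}) (q : {rmorphism F -> Q}).
Variables (m : set R) (J L : set F) (f : F) (N l : nat).
Hypotheses (pi_surj : forall y, exists x, pi x = y) (q_surj : forall y, exists x, q x = y).
Hypothesis qE : forall x, q x = 0 <-> J x.
Hypotheses (hm : residually_field m) (hR : noetherian R) (ml : ideal_exp m l = [set 0]).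
Let n := pi @^-1` m.
Hypotheses (hJ : is_ideal J) (Jn : J `<=` n) (nJ : ideal_exp n N `<=` J).
Hypotheses (hL : is_ideal L) (kerL : pi @^-1` [set 0] `<=` L).
Hypothesis LE : L = ideal_add J (ideal_gen [set f]).
Hypotheses (nf : forall u, n u -> J (u * f)) (Jf : ~ J f).
Hypothesis colonL : forall x, (forall u, n u -> J (x * u)) -> L x.

Lemma residually_field_preimage : residually_field n.
Proof.
have [hmi m1 mfield] := hm; split; first exact: is_ideal_preimage.
  by rewrite /n /= rmorph1.
move=> c /mfield[d' md]; have [d dE] := pi_surj d'; exists d.
by rewrite /n /= rmorphB rmorphM rmorph1 dE.
Qed.

Lemma image_preimage_ker x : (q @` n) (q x) -> n x.
Proof.
have [hn _ _] := residually_field_preimage.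
move=> [y ny qyx]; apply: (idealB_cancel hn ny); apply: Jn; apply/qE.
by rewrite rmorphB qyx subrr.
Qed.

Lemma residually_field_image : residually_field (q @` n).
Proof.
have [hn n1 nfield] := residually_field_preimage; split.
- exact: is_ideal_image.
- by rewrite -(rmorph1 q) => /image_preimage_ker.
- move=> y; have [x <-] := q_surj y => nqx.
  have [|d nd] := nfield x; first by move=> nx; apply: nqx; exists x.
  by exists (q d); exists (1 - x * d); rewrite ?rmorphB ?rmorphM ?rmorph1.
Qed.

Lemma image_ker I : is_ideal I -> I `<=` J -> q @` I = [set 0].
Proof.
move=> hI IJ; apply/seteqP; split=> [_ [x /IJ/qE qx <-] //|_ ->].
by exists 0; [exact: ideal_0|rewrite rmorph0].
Qed.

Lemma quotient_socle_generator : socle_generator (q @` n) (q f).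
Proof.
split; first by move/qE.
apply/seteqP; split; last first.
  apply: ideal_gen_min; first exact: is_ideal_ann.
  move=> _ -> _ [u nu <-]; rewrite mulrC -rmorphM; apply/qE; exact: nf.
move=> y yn; have [x xy] := q_surj y; rewrite -{y}xy in yn *.
have : L x.
  apply: colonL => u nu; apply/qE; rewrite rmorphM; apply: yn; by exists u.
rewrite LE => -[j /qE qj [z]]; rewrite !ideal_gen1 => -[a _ <-] <-.
by exists (q a) => //; rewrite rmorphD rmorphM qj add0r.
Qed.

(** F need not be Noetherian, so finite length is carried over from R: a chain from 0 to R is pulled
    back to F, added to L, prolonged below by the step from J to L, and pushed forward to Q. *)
Lemma quotient_gorenstein : artinian_gorenstein_local (q @` n).
Proof.
have hn := residually_field_preimage.
have [k ck] := chain_exists hm ml hR (is_ideal_set0 R) (is_idealT R) (fun x _ => Logic.I).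
have := chain_add hL (chain_preimage pi_surj ck).
have -> : ideal_add L (pi @^-1` [set 0]) = L.
  apply/seteqP; split; first exact: ideal_add_sub.
  by apply: ideal_addl; apply: is_ideal_preimage; apply: is_ideal_set0.
have -> : ideal_add L (pi @^-1` [set: R]) = setT.
  by apply/seteqP; split=> // x _; exists 0; [exact: ideal_0|exists x; rewrite ?add0r].
move=> cL.
have cJ : chain n false J 1 L.
  apply: ChainS (Chain0 _ _ hJ) hL _ _ => //.
  by rewrite LE; apply: simple_step_adjoin.
have := chain_image q_surj (chain_cat cJ cL).
have qT : q @` setT = setT.
  by apply/seteqP; split=> // y _; have [x <-] := q_surj y; exists x.
rewrite (image_ker hJ) // qT => cQ.
split.
- apply: (@nilpotent_local _ _ N); first exact: residually_field_image.
  by rewrite -ideal_exp_image // image_ker //; exact: is_ideal_exp.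
- exact: chain_noetherian cQ.
- exact: chain_artinian cQ.
- by exists (q f); exact: quotient_socle_generator.
Qed.

Lemma quotient_loewy_length p : ideal_exp n p f -> ideal_exp n p.+1 `<=` J ->
  loewy_length (q @` n) = p.
Proof.
move=> nf' nJ'; apply: loewy_lengthE; rewrite -ideal_exp_image //.
  move=> h; have : (q @` ideal_exp n p) (q f) by exists f.
  by rewrite h /= => /qE.
by apply: image_ker => //; exact: is_ideal_exp.
Qed.

End GorensteinQuotient.

(** * The two summands *)

Lemma ideal_add_gen (A : comNzRingType) (J X : set A) (g : A) :
  is_ideal J -> is_ideal X -> J `<=` X -> X g ->
  (forall x, X x -> exists a, J (x - a * g)) -> X = ideal_add J (ideal_gen [set g]).
Proof.
move=> hJ hX JX Xg red; apply/seteqP; split=> [x /red[a Ja]|].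
  by exists (x - a * g) => //; exists (a * g); rewrite ?subrK // ideal_gen1; exists a.
by apply: ideal_add_sub => //; apply: ideal_gen_min => // _ ->.
Qed.

Section Summands.
Variables (R F : comNzRingType) (pi : {rmorphism F -> R}).
Variables (m W : set R) (w : R -> R) (d : R) (l : nat).
Hypotheses (pi_surj : forall y, exists x, pi x = y).
Hypotheses (hm : residually_field m) (hR : noetherian R) (hd : socle_generator m d).
Hypotheses (l3 : (3 <= l)%N) (mld : ideal_exp m l d).
Hypothesis ml1 : ideal_exp m l.+1 = [set 0].
Hypotheses (hW : is_ideal W) (W2 : W `<=` ann (ideal_exp m 2)) (mW : ann m `<=` W).
Hypothesis WZ : forall x, W x -> ann W x -> ann m x.
Hypothesis Ww : forall u, m u -> W (w u).
Hypothesis Zw : forall u, m u -> ann W (u - w u).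
Hypothesis Wd : exists w u, [/\ W w, m u & w * u = d].

Lemma socle_annihilates : ann m `<=` ann W.
Proof.
have [hmi _ _] := hm.
move=> x /(socle_multiple hd)[c ->] y Wy; rewrite -mulrA mulrC.
have -> : d * y = 0; last by rewrite mul0r.
by rewrite mulrC W2 //; apply: ideal_exp_le mld; apply: leq_trans l3.
Qed.

Lemma summand_proper : W `<=` m.
Proof.
move=> x Wx; apply: (socle_unit hm hd); rewrite W2 //.
by apply: ideal_exp_le mld; apply: leq_trans l3.
Qed.

Lemma complement_proper : ann W `<=` m.
Proof.
move=> x Zx; apply: (socle_unit hm hd); have [w0 [u0 [Ww0 mu0 <-]]] := Wd.
by rewrite mulrA Zx // mul0r.
Qed.

Lemma form_absorb u v : m u -> W v -> w u * v = u * v.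
Proof. by move=> mu Wv; apply/esym/eqP; rewrite -subr_eq0 -mulrBl Zw. Qed.

(** Both sides equal w u * w v, since the Z-component of either argument kills W. *)
Lemma form_sym u v : m u -> m v -> w u * v = w v * u.
Proof.
move=> mu mv; have h u' v' : m u' -> m v' -> w u' * v' = w u' * w v'.
  move=> mu' mv'; apply/eqP; rewrite -subr_eq0 -mulrBr mulrC Zw //; exact: Ww.
by rewrite h // mulrC -h.
Qed.

Lemma form_square u v v' : m u -> m v -> m v' -> w u * (v * v') = 0.
Proof.
have [hmi _ _] := hm; move=> mu mv mv'; apply: (W2 (Ww mu)).
exact: ideal_exp2_sub.
Qed.

(** * The functional psi and the ideal defining T *)

Hypothesis pi_square : induces_on_square m w pi.

Definition form (s : seq (F * F)) := \sum_(p <- s) w (pi p.1) * pi p.2.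
Definition value (s : seq (F * F)) := \sum_(p <- s) p.1 * p.2.

Let n := pi @^-1` m.
Let L := pi @^-1` (ann W).
Let K := pi @^-1` W.
Let n_field : residually_field n. Proof. exact: residually_field_preimage. Qed.
Let n_ideal : is_ideal n. Proof. by case: n_field. Qed.
Let m_ideal : is_ideal m. Proof. by case: hm. Qed.
Let L_ideal : is_ideal L. Proof. exact/is_ideal_preimage/is_ideal_ann. Qed.
Let K_ideal : is_ideal K. Proof. exact: is_ideal_preimage. Qed.
Let Ln : L `<=` n. Proof. by move=> x /complement_proper. Qed.
Let Kn : K `<=` n. Proof. by move=> x /summand_proper. Qed.

Lemma form_cat s t : form (s ++ t) = form s + form t.
Proof. by rewrite /form big_cat. Qed.

Lemma value_cat s t : value (s ++ t) = value s + value t.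
Proof. by rewrite /value big_cat. Qed.

Definition scale_pairs a (s : seq (F * F)) := [seq (a * p.1, p.2) | p <- s].

Lemma form_scale a s : pairs_in n n s -> form (scale_pairs a s) = pi a * form s.
Proof.
move=> hs; rewrite /form big_map mulr_sumr big_seq [RHS]big_seq.
apply: eq_bigr => p /hs[p1 p2] /=.
by rewrite rmorphM (symmetric_scale hm form_sym).
Qed.

Lemma value_scale a s : value (scale_pairs a s) = a * value s.
Proof. by rewrite /value big_map mulr_sumr; apply: eq_bigr => p _; rewrite mulrA. Qed.

Lemma pairs_in_square s : pairs_in n n s -> ideal_mul n n (value s).
Proof. by move=> hs; apply/ideal_mulP => //; exists s. Qed.

Lemma form_uniq s t : pairs_in n n s -> pairs_in n n t -> value s = value t ->
  form s = form t.
Proof.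
move=> hs ht st; have := @pi_square (s ++ scale_pairs (-1) t).
rewrite -/(form _) -/(value _) form_cat value_cat form_scale // value_scale st.
rewrite rmorphN1 !mulN1r subrr => h; apply/eqP; rewrite -subr_eq0; apply/eqP/h => //.
by apply: pairs_in_cat => //; apply: pairs_in_scale.
Qed.

Definition form_kernel : set F :=
  [set x | exists s, [/\ pairs_in n n s, x = value s & form s = 0]].

Lemma form_kernel_ideal : is_ideal form_kernel.
Proof.
split.
- by exists [::]; split=> //; rewrite /value /form big_nil.
- move=> x y [s [hs -> s0]] [t [ht -> t0]]; exists (s ++ t).
  by rewrite value_cat form_cat s0 t0 addr0; split=> //; apply: pairs_in_cat.
- move=> a _ [s [hs -> s0]]; exists (scale_pairs a s).
  by rewrite value_scale form_scale // s0 mulr0; split=> //; apply: pairs_in_scale.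
Qed.

Lemma square_sub_L : ideal_mul n n `<=` L.
Proof.
apply: (ideal_mul_min L_ideal) => u v nu nv y Wy; rewrite rmorphM mulrC.
by rewrite (W2 Wy) //; apply: ideal_exp2_sub.
Qed.

Lemma form_pair u v : form [:: (u, v)] = w (pi u) * pi v.
Proof. by rewrite /form big_seq1. Qed.

Lemma value_pair u v : value [:: (u, v)] = u * v.
Proof. by rewrite /value big_seq1. Qed.

Lemma pairs_in_pair u v : n u -> n v -> pairs_in n n [:: (u, v)].
Proof. by move=> nu nv p; rewrite inE => /eqP ->. Qed.

(** JT is a complement of n^2 in L modulo the kernel of the form on n^2, so the functional extends
    to L by zero on JT. The complement exists because n * L already lies in that kernel. *)
Lemma exists_JT : exists J, [/\ is_ideal J, J `<=` L, form_kernel `<=` J,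
    (forall x, J x -> ideal_mul n n x -> form_kernel x) &
    (forall x, L x -> exists j y, [/\ J j, ideal_mul n n y & x = j + y])].
Proof.
apply: (ideal_complement n_field form_kernel_ideal (is_ideal_mul _ _) L_ideal _ square_sub_L).
  by move=> _ [s [hs -> _]]; apply: pairs_in_square.
move=> u g nu Lg; exists [:: (u, g)]; split; rewrite ?value_pair //.
  by apply: pairs_in_pair => //; apply: Ln.
by rewrite form_pair mulrC Lg //; apply: Ww.
Qed.

Variable JT : set F.
Hypotheses (JT_ideal : is_ideal JT) (JTL : JT `<=` L) (kerJT : form_kernel `<=` JT).
Hypothesis JT_square : forall x, JT x -> ideal_mul n n x -> form_kernel x.
Hypothesis JT_split : forall x, L x -> exists j y, [/\ JT j, ideal_mul n n y & x = j + y].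

(* The graph of the extension to L of the functional that the form induces on n^2;
   its kernel is JT. *)
Definition psi x r :=
  exists j s, [/\ JT j, pairs_in n n s, x = j + value s & r = form s].

Lemma psi_total x : L x -> exists r, psi x r.
Proof.
move=> /JT_split[j [y [JTj /(ideal_mulP _ _ n_ideal)[s hs yE] ->]]].
by exists (form s), j, s; split=> //; rewrite yE.
Qed.

Lemma psi_L x r : psi x r -> L x.
Proof.
move=> [j [s [/JTL Lj hs -> _]]]; apply: (idealD L_ideal) => //.
by apply: square_sub_L; apply: pairs_in_square.
Qed.

Lemma psi_uniq x r r' : psi x r -> psi x r' -> r = r'.
Proof.
move=> [j [s [JTj hs -> ->]]] [j' [s' [JTj' hs' E ->]]].
have E' : value (s ++ scale_pairs (-1) s') = j' - j.
  rewrite value_cat value_scale mulN1r; apply/eqP; rewrite subr_eq addrAC eq_sym.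
  by rewrite subr_eq -E addrC.
have hss : pairs_in n n (s ++ scale_pairs (-1) s').
  by apply: pairs_in_cat => //; apply: pairs_in_scale.
have [||t [ht tE t0]] := @JT_square (j' - j).
- exact: idealB.
- by rewrite -E'; apply: pairs_in_square.
have := form_uniq hss ht; rewrite E' -tE => /(_ erefl).
rewrite form_cat form_scale // t0 rmorphN1 mulN1r => /eqP.
by rewrite subr_eq0 => /eqP.
Qed.

Lemma psi_add x y r r' : psi x r -> psi y r' -> psi (x + y) (r + r').
Proof.
move=> [j [s [JTj hs -> ->]]] [j' [s' [JTj' hs' -> ->]]].
exists (j + j'), (s ++ s'); rewrite value_cat form_cat addrACA; split=> //.
  exact: idealD.
exact: pairs_in_cat.
Qed.

Lemma psi_scale a x r : psi x r -> psi (a * x) (pi a * r).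
Proof.
move=> [j [s [JTj hs -> ->]]]; exists (a * j), (scale_pairs a s).
rewrite value_scale form_scale // mulrDr; split=> //; first exact: ideal_mull.
exact: pairs_in_scale.
Qed.

Lemma psi_opp x r : psi x r -> psi (- x) (- r).
Proof. by rewrite -mulN1r -[- r]mulN1r -(rmorphN1 pi); apply: psi_scale. Qed.

Lemma psi_sub x y r r' : psi x r -> psi y r' -> psi (x - y) (r - r').
Proof. by move=> hx /psi_opp; apply: psi_add. Qed.

Lemma psi_JT x : JT x <-> psi x 0.
Proof.
split=> [JTx|[j [s [JTj hs -> s0]]]].
  exists x, [::]; split=> //; first by rewrite /value big_nil addr0.
  by rewrite /form big_nil.
by apply: idealD => //; apply: kerJT; exists s.
Qed.

Lemma psi_mul u v : n u -> n v -> psi (u * v) (w (pi u) * pi v).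
Proof.
move=> nu nv; exists 0, [:: (u, v)]; rewrite form_pair value_pair add0r; split=> //.
  exact: ideal_0.
exact: pairs_in_pair.
Qed.

Lemma psi_nL u g : n u -> L g -> psi (u * g) 0.
Proof.
move=> nu Lg; suff <- : w (pi u) * pi g = 0 by apply: psi_mul => //; apply: Ln.
by rewrite mulrC Lg //; apply: Ww.
Qed.

(** A product with an element of W sees only the W-component of the other factor. Hence pi - psi
    vanishes on n * K, the condition for extending it to K. *)
Lemma psi_nK u g : n u -> K g -> psi (u * g) (pi (u * g)).
Proof.
move=> nu Kg; rewrite rmorphM -form_absorb //; apply: psi_mul => //; exact: Kn.
Qed.

Lemma psi_socle x r : psi x r -> ann m r.
Proof.
move=> [j [s [_ hs _ ->]]] a ma; rewrite /form mulr_suml big_seq big1 // => p /hs[p1 p2].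
by rewrite -mulrA form_square.
Qed.

(** n^2 lies in L, and psi is zero on n * L because W Z = 0. This makes the cube of the maximal
    ideal of T vanish. *)
Lemma psi_cube : ideal_exp n 3 `<=` JT.
Proof.
apply: (ideal_mul_min JT_ideal) => u v nu nv; apply/psi_JT; apply: psi_nL => //.
by apply: square_sub_L; rewrite -ideal_exp2.
Qed.

(** * The difference of pi and psi and the ideal defining S *)

Let N0 := [set x | psi x (pi x)].

Lemma N0_ideal : is_ideal N0.
Proof.
split=> [|x y|a x]; rewrite /N0 /=.
- by rewrite rmorph0; by apply/psi_JT; apply: ideal_0.
- by rewrite rmorphD; apply: psi_add.
- by rewrite rmorphM; apply: psi_scale.
Qed.

Lemma exists_JS : exists J, [/\ is_ideal J, J `<=` K, N0 `<=` J,
    (forall x, J x -> ann m (pi x) -> N0 x) &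
    (forall x, K x -> exists j y, [/\ J j, ann m (pi y) & x = j + y])].
Proof.
apply: (ideal_complement n_field N0_ideal (is_ideal_preimage pi (is_ideal_ann m)) K_ideal).
- by move=> x /psi_socle.
- by move=> x /mW.
- exact: psi_nK.
Qed.

Variable JS : set F.
Hypotheses (JS_ideal : is_ideal JS) (JSK : JS `<=` K) (N0JS : N0 `<=` JS).
Hypothesis JS_socle : forall x, JS x -> ann m (pi x) -> N0 x.
Hypothesis JS_split : forall x, K x -> exists j y, [/\ JS j, ann m (pi y) & x = j + y].

Lemma exists_e : exists2 e, ideal_exp n 2 e & psi e d.
Proof.
have [w0 [u0 [Ww0 mu0 wud]]] := Wd.
have [v vE] := pi_surj w0; have [u uE] := pi_surj u0.
have nu : n u by rewrite /n /= uE.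
have Kv : K v by rewrite /K /= vE.
have uvE : pi (u * v) = d by rewrite rmorphM uE vE mulrC.
exists (u * v); first by apply: ideal_exp2_sub => //; apply: Kn.
by rewrite -[in X in psi _ X]uvE; apply: psi_nK.
Qed.

Lemma exists_f : exists2 f, ideal_exp n l f & pi f = d.
Proof.
have : (pi @` ideal_exp n l) d.
  rewrite (ideal_exp_image pi_surj); suff -> : pi @` n = m by [].
  apply/seteqP; split=> [_ [x nx <-] //|y my]; have [x xy] := pi_surj y.
  by exists x => //; rewrite /n /= xy.
by move=> [f nf fd]; exists f.
Qed.

Variables e f : F.
Hypotheses (ne : ideal_exp n 2 e) (psi_e : psi e d).
Hypotheses (nf : ideal_exp n l f) (pi_f : pi f = d).

(** This uses l >= 3: f lies in n^l, hence in n^3, and so vanishes in T. *)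
Lemma psi_f : psi f 0.
Proof. by apply/psi_JT; apply: psi_cube; apply: ideal_exp_le nf. Qed.

Lemma L_reduce x : L x -> exists a, JT (x - a * e).
Proof.
move=> /psi_total[r xr]; have [c rE] := socle_multiple hd (psi_socle xr).
have [a aE] := pi_surj c; exists a; apply/psi_JT.
have := psi_sub xr (psi_scale a psi_e); by rewrite aE -rE subrr.
Qed.

Let pi_f_socle a : ann m (pi (a * f)).
Proof.
move=> b mb; rewrite rmorphM pi_f mulrC mulrCA (socle_mul0 hd) ?mulr0 //.
Qed.

Lemma socle_reduce x : ann m (pi x) -> exists a, JS (x - a * f).
Proof.
move=> sx; have [r xr] := psi_total (socle_annihilates sx).
(* The difference pi x - psi x is c * d; since pi - psi sends f to d, subtracting a lift of c times
   f lands in N0. *)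
have sr : ann m (pi x - r).
  by apply: (idealB (is_ideal_ann m)) => //; exact: psi_socle xr.
have [c rE] := socle_multiple hd sr.
have [a aE] := pi_surj c; exists a; apply: N0JS; rewrite /N0 /=.
have -> : pi (x - a * f) = r - pi a * 0.
  by rewrite rmorphB rmorphM pi_f aE -rE opprB mulr0 subr0 addrC subrK.
exact: psi_sub xr (psi_scale a psi_f).
Qed.

Lemma K_reduce x : K x -> exists a, JS (x - a * f).
Proof.
move=> /JS_split[j [y [JSj /socle_reduce[a JSy] ->]]]; exists a.
by rewrite -addrA; apply: (idealD JS_ideal).
Qed.

Lemma JT_e : ~ JT e.
Proof.
by move=> /psi_JT/(psi_uniq psi_e) d0; case: hd.
Qed.

Lemma JS_f : ~ JS f.
Proof.
move=> JSf; have : N0 f.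
  apply: JS_socle => //; rewrite -[f]mul1r; exact: pi_f_socle.
by move=> /(psi_uniq psi_f); rewrite pi_f => /esym d0; case: hd.
Qed.

Let Le : L e. Proof. exact: psi_L psi_e. Qed.
Let Kf : K f. Proof. by apply: mW; rewrite -[f]mul1r; apply: pi_f_socle. Qed.

Lemma L_generated : L = ideal_add JT (ideal_gen [set e]).
Proof. exact: ideal_add_gen L_reduce. Qed.

Lemma K_generated : K = ideal_add JS (ideal_gen [set f]).
Proof. exact: ideal_add_gen K_reduce. Qed.

(** psi (x * e) = pi x * d = 0 puts x in n; then psi (x * u) = w (pi x) * pi u = 0 puts the
    W-component of pi x in the socle, which is contained in Z. *)
Lemma JT_colon x : (forall u, n u -> JT (x * u)) -> L x.
Proof.
move=> hx.
have n_e : n e by apply: Ln.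
have nx : n x.
  apply: (socle_unit hm hd); apply: psi_uniq (psi_scale x psi_e) _.
  exact/psi_JT/hx.
have sx : ann m (w (pi x)).
  move=> a ma; have [u uE] := pi_surj a.
  have nu : n u by rewrite /n /= uE.
  by rewrite -uE; apply: psi_uniq (psi_mul nx nu) _; apply/psi_JT/hx.
rewrite /L /= -(subrK (w (pi x)) (pi x)).
by apply: (idealD (is_ideal_ann W)); [exact: Zw|exact: socle_annihilates].
Qed.

Lemma JS_colon x : (forall u, n u -> JS (x * u)) -> K x.
Proof.
move=> hx.
have n_f : n f by apply: Kn.
have nx : n x.
  apply: (socle_unit hm hd); have h1 := psi_scale x psi_f.
  have h2 : N0 (x * f) by apply: JS_socle; [exact: hx|exact: pi_f_socle].
  by rewrite -pi_f -rmorphM -(psi_uniq h1 h2) mulr0.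
have [g gE] := pi_surj (w (pi x)).
have Kg : K g by rewrite /K /= gE; apply: Ww.
have Lxg : L (x - g) by rewrite /L /= rmorphB gE; apply: Zw.
(* u * g lies in N0, so u * (x - g) is in JS. It also lies in L, and on the part of JS over the
   socle pi agrees with psi, which is 0 on n * L. *)
have sxg : ann m (pi (x - g)).
  move=> a ma; have [u uE] := pi_surj a; rewrite -uE -rmorphM mulrC.
  have nu : n u by rewrite /n /= uE.
  have JSu : JS (u * (x - g)).
    rewrite mulrBr; apply: idealB => //; first by rewrite mulrC; apply: hx.
    by apply: N0JS; apply: psi_nK.
  have h : N0 (u * (x - g)).
    apply: JS_socle => //; apply: WZ; first exact: JSK.
    by apply: (ideal_mull u L_ideal).
  by rewrite -(psi_uniq (psi_nL nu Lxg) h).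
by rewrite -(subrK g x); apply: (idealD K_ideal) => //; apply: mW.
Qed.

Lemma kerL : pi @^-1` [set 0] `<=` L.
Proof. by move=> x /= x0; rewrite /L /= x0; apply: ideal_0; exact: is_ideal_ann. Qed.

Lemma kerK : pi @^-1` [set 0] `<=` K.
Proof. by move=> x /= x0; rewrite /K /= x0; apply: ideal_0. Qed.

Lemma JT_e_n u : n u -> JT (u * e).
Proof. by move=> nu; apply/psi_JT; apply: psi_nL. Qed.

Lemma JS_f_n u : n u -> JS (u * f).
Proof. by move=> nu; apply: N0JS; apply: psi_nK. Qed.

Lemma JS_power : ideal_exp n l.+1 `<=` JS.
Proof.
move=> x nx; apply: N0JS; rewrite /N0 /=.
have -> : pi x = 0.
  have : (pi @` ideal_exp n l.+1) (pi x) by exists x.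
  rewrite (ideal_exp_image pi_surj) => h.
  suff : ideal_exp m l.+1 (pi x) by rewrite ml1.
  suff <- : pi @` n = m by [].
  apply/seteqP; split=> [_ [y ny <-] //|y my]; have [z zy] := pi_surj y.
  by exists z => //; rewrite /n /= zy.
by apply/psi_JT; apply: psi_cube; apply: ideal_exp_le nx; apply: ltnW.
Qed.

Variables (S T : comNzRingType).
Variables (qS : {rmorphism F -> S}) (qT : {rmorphism F -> T}).
Hypotheses (qS_surj : forall y, exists x, qS x = y) (qSE : forall x, qS x = 0 <-> JS x).
Hypotheses (qT_surj : forall y, exists x, qT x = y) (qTE : forall x, qT x = 0 <-> JT x).

Let JSn : JS `<=` n. Proof. by move=> x /JSK/Kn. Qed.
Let JTn : JT `<=` n. Proof. by move=> x /JTL/Ln. Qed.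

Lemma S_socle_generator : socle_generator (qS @` n) (qS f).
Proof.
exact: (quotient_socle_generator qS_surj qSE K_generated JS_f_n JS_f JS_colon).
Qed.

Lemma T_socle_generator : socle_generator (qT @` n) (qT e).
Proof.
exact: (quotient_socle_generator qT_surj qTE L_generated JT_e_n JT_e JT_colon).
Qed.

Lemma S_gorenstein : artinian_gorenstein_local (qS @` n).
Proof.
exact: (quotient_gorenstein pi_surj qS_surj qSE hm hR ml1 JS_ideal JSn JS_power
  K_ideal kerK K_generated JS_f_n JS_f JS_colon).
Qed.

Lemma T_gorenstein : artinian_gorenstein_local (qT @` n).
Proof.
exact: (quotient_gorenstein pi_surj qT_surj qTE hm hR ml1 JT_ideal JTn psi_cube
  L_ideal kerL L_generated JT_e_n JT_e JT_colon).
Qed.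

Lemma S_loewy_length : loewy_length (qS @` n) = l.
Proof. exact: (quotient_loewy_length qS_surj qSE JS_f nf JS_power). Qed.

Lemma T_loewy_length : loewy_length (qT @` n) = 2%N.
Proof. exact: (quotient_loewy_length qT_surj qTE JT_e ne psi_cube). Qed.

(** * R as a quotient of the fiber product *)

Section Isomorphism.
Variables (k : fieldType) (pS : {rmorphism S -> k}) (pT : {rmorphism T -> k}).
Variable p : {rmorphism F -> k}.
Hypotheses (pSE : forall x, pS (qS x) = p x) (pTE : forall x, pT (qT x) = p x).
Hypothesis pE : forall x, p x = 0 <-> n x.

Let fiber_inP x y : n (x - y) -> (qS x, qT y) \in fiber_pred pS pT.
Proof.
by move/pE; rewrite rmorphB => /subr0_eq xy; rewrite unfold_in /fiber_pred /= pSE pTE xy.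
Qed.

Let n_diag x : n (x - x). Proof. by rewrite subrr; apply: ideal_0. Qed.

Definition to_fiber x : fiber_product pS pT := FiberProduct (fiber_inP (n_diag x)).

Fact to_fiber_zmod_morphism : zmod_morphism to_fiber.
Proof. by move=> x y; apply: val_inj; rewrite /= !rmorphB. Qed.

Fact to_fiber_monoid_morphism : monoid_morphism to_fiber.
Proof.
by split=> [|x y]; apply: val_inj; rewrite /= ?rmorph1 ?rmorphM.
Qed.

HB.instance Definition _ := GRing.isZmodMorphism.Build F (fiber_product pS pT)
  to_fiber to_fiber_zmod_morphism.
HB.instance Definition _ := GRing.isMonoidMorphism.Build F (fiber_product pS pT)
  to_fiber to_fiber_monoid_morphism.

Variable dd : fiber_product pS pT.
Hypothesis ddE : fiber_val dd = (qS f, - qT e).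

Lemma fiber_lift (c : fiber_product pS pT) : exists a b,
  [/\ qS a = (fiber_val c).1, qT b = (fiber_val c).2 & n (a - b)].
Proof.
have [a aE] := qS_surj (fiber_val c).1; have [b bE] := qT_surj (fiber_val c).2.
exists a, b; split=> //; apply/pE; rewrite rmorphB -pSE -pTE aE bE.
by case: c {aE bE} => c /= /eqP ->; rewrite subrr.
Qed.

Lemma to_fiber_ker x : pi x = 0 <-> ideal_gen [set dd] (to_fiber x).
Proof.
rewrite ideal_gen1; split=> [x0|[c _ /(congr1 val) cE]].
  have sx : ann m (pi x) by rewrite x0; apply: ideal_0; exact: is_ideal_ann.
  have [r xr] := psi_total (socle_annihilates sx).
  have [c rE] := socle_multiple hd (psi_socle xr).
  have [a aE] := pi_surj (- c).
  have JTx : JT (x + a * e).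
    apply/psi_JT; have := psi_add xr (psi_scale a psi_e).
    by rewrite aE rE mulNr subrr.
  have JSx : JS (x - a * f).
    apply: N0JS; rewrite /N0 /=; have := psi_sub xr (psi_scale a psi_f).
    by rewrite mulr0 subr0 rmorphB rmorphM x0 pi_f aE sub0r mulNr opprK rE.
  exists (to_fiber a) => //; apply: val_inj; rewrite /= ddE.
  move/qSE: JSx => /eqP; rewrite rmorphB subr_eq0 rmorphM => /eqP ->.
  move/qTE: JTx => /eqP; rewrite rmorphD addr_eq0 rmorphM => /eqP ->.
  by rewrite -mulrN.
(* Conversely, for c = (qS a, qT b) one finds psi x = - pi b * d and pi x - psi x = pi a * d. So pi
   x = (pi a - pi b) * d, which is 0 because a - b is in n. *)
have [a [b [aE bE nab]]] := fiber_lift c.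
have JSx : JS (x - a * f).
  by apply/qSE; rewrite rmorphB rmorphM aE; move: cE; rewrite /= ddE => -[<- _]; rewrite subrr.
have JTx : JT (x + b * e).
  apply/qTE; rewrite rmorphD rmorphM bE; move: cE; rewrite /= ddE => -[_ <-].
  by rewrite mulrN addNr.
have Kx : K x by apply: (idealB_cancel K_ideal) (JSK JSx); apply: (ideal_mull _ K_ideal).
have Lx : L x by apply: (idealDr_cancel L_ideal) (JTL JTx); apply: (ideal_mull _ L_ideal).
have [r xr] := psi_total Lx.
have rE : r + pi b * d = 0.
  by apply: psi_uniq (psi_add xr (psi_scale b psi_e)) _; apply/psi_JT.
have N0x : N0 (x - a * f).
  apply: JS_socle => //; rewrite rmorphB; apply: (idealB (is_ideal_ann m)) => //.
  exact: WZ.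
have := psi_uniq (psi_sub xr (psi_scale a psi_f)) N0x.
rewrite mulr0 subr0 rmorphB rmorphM pi_f => rE'.
have -> : pi x = (pi a - pi b) * d + (r + pi b * d) by rewrite rE'; ring.
by rewrite rE addr0 -rmorphB (socle_mul0 hd).
Qed.

Lemma to_fiber_surj c : exists x, ideal_gen [set dd] (c - to_fiber x).
Proof.
have [a [b [aE bE nab]]] := fiber_lift c.
have nc : m (pi (b - a)).
  by rewrite -opprB rmorphN; apply: idealN.
have [g gE] := pi_surj (w (pi (b - a))).
have Kg : K g by rewrite /K /= gE; apply: Ww.
have Lg : L (b - a - g) by rewrite /L /= rmorphB gE; apply: Zw.
have [t JTt] := L_reduce Lg; have [t' JSt] := K_reduce Kg.
(* a + g - t' * f agrees with c in S and misses it by t * e in T. Adding t * f, which is 0 in T,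
   turns the discrepancy into - t times (f, - e). *)
exists (a + g - t' * f + t * f); rewrite ideal_gen1; exists (- to_fiber t) => //.
have qTf : qT f = 0 by apply/qTE/psi_JT/psi_f.
have qSg : qS g = qS t' * qS f.
  by apply/eqP; rewrite -subr_eq0 -rmorphM -rmorphB; apply/eqP/qSE.
have qTg : qT b - qT a - qT g = qT t * qT e.
  by apply/eqP; rewrite -subr_eq0 -rmorphM -!rmorphB; apply/eqP/qTE.
apply: val_inj; rewrite /= ddE; case: (fiber_val c) aE bE => [c1 c2] /= <- <-.
congr pair; rewrite !rmorphD !rmorphN !rmorphM ?qTf ?qSg /=; first by ring.
have -> : qT b = qT t * qT e + qT g + qT a by rewrite -qTg !subrK.
by ring.
Qed.

Lemma fiber_quotient_iso (I : idealr (fiber_product pS pT)) :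
    [set x | x \in I] = ideal_gen [set dd] ->
  exists h : {rmorphism R -> {ideal_quot I}}, bijective h.
Proof.
move=> IE; pose g : {rmorphism F -> {ideal_quot I}} := quotient_map I \o to_fiber.
have gE x : g x = 0 <-> pi x = 0.
  by rewrite to_fiber_ker -IE; exact: quotient_map_eq0.
have [h hE] : exists h : {rmorphism R -> {ideal_quot I}}, forall x, h (pi x) = g x.
  by apply: rmorphism_factor => // x /gE.
exists h.
have h_inj : injective h.
  move=> y z hyz; have [x xE] := pi_surj (y - z).
  apply/eqP; rewrite -subr_eq0 -xE; apply/eqP/gE.
  by rewrite -hE xE rmorphB hyz subrr.
have h_surj y : exists x, h x = y.
  have [c <-] := quotient_map_surj y; have [x] := to_fiber_surj c.
  rewrite -IE => /quotient_map_eq0; rewrite rmorphB => /subr0_eq cE.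
  by exists (pi x); rewrite hE.
have [s sK] := choice h_surj.
by exists s => // x; apply: h_inj.
Qed.

End Isomorphism.

Lemma quotients_connected_sum : is_connected_sum R (qS @` n) (qT @` n).
Proof.
have n_e : n e by apply/Ln/psi_L/psi_e.
have n_f : n f by apply: Kn; apply: mW; rewrite -[f]mul1r; apply: pi_f_socle.
have [k [p [p_surj pE]]] := residue_field_exists n_field.
have [pS pSE] : exists pS : {rmorphism S -> k}, forall x, pS (qS x) = p x.
  by apply: rmorphism_factor => // x /qSE/JSn/pE.
have [pT pTE] : exists pT : {rmorphism T -> k}, forall x, pT (qT x) = p x.
  by apply: rmorphism_factor => // x /qTE/JTn/pE.
have residue (Q : comNzRingType) (q : {rmorphism F -> Q}) (r : {rmorphism Q -> k}) :
    (forall y, exists x, q x = y) -> (forall x, r (q x) = p x) ->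
    residue_map (q @` n) r.
  move=> q_surj rE; split=> [c|].
    by have [x <-] := p_surj c; exists (q x).
  apply/seteqP; split=> [y /= ry|_ [x nx <-]] /=; last by rewrite rE; apply/pE.
  by have [x xE] := q_surj y; exists x => //; apply/pE; rewrite -rE xE.
split.
- move=> S0; have : (qS @` n) (qS f) by exists f.
  by rewrite S0 => /qSE/JS_f.
- move=> T0; have : (qT @` n) (qT e) by exists e.
  by rewrite T0 => /qTE/JT_e.
exists k, pS, pT; split; [exact: residue|exact: residue|].
have ddP : (qS f, - qT e) \in fiber_pred pS pT.
  rewrite unfold_in /fiber_pred /= rmorphN pSE pTE.
  by rewrite (pE f).2 // (pE e).2 // oppr0.
pose dd := FiberProduct ddP; exists (qS f), (qT e), dd.
have dd1 : ~ ideal_gen [set dd] 1.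
  rewrite ideal_gen1 => -[c _ /(congr1 val) /= [c1 _]].
  have := congr1 pS c1; rewrite rmorphM pSE (pE f).2 // mulr0 rmorph1 => /eqP.
  by rewrite eq_sym oner_eq0.
split=> //; [exact: S_socle_generator|exact: T_socle_generator|].
exists (bundled_ideal (is_ideal_gen _) dd1); split; first exact: bundled_idealE.
by apply: (fiber_quotient_iso pSE pTE pE (dd := dd)) => //; exact: bundled_idealE.
Qed.

Lemma quotients_decomposition :
  [/\ artinian_gorenstein_local (qS @` n), artinian_gorenstein_local (qT @` n),
      loewy_length (qS @` n) = l, loewy_length (qT @` n) = 2%N &
      is_connected_sum R (qS @` n) (qT @` n)].
Proof.
split; [exact: S_gorenstein|exact: T_gorenstein|exact: S_loewy_length|
  exact: T_loewy_length|exact: quotients_connected_sum].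
Qed.

End Summands.

(** * The theorem *)

Lemma connected_sum_exists (R : comNzRingType) (m : set R) :
    artinian_gorenstein_local m -> (3 <= loewy_length m)%N ->
    ~ (ann (ideal_exp m 2) `<=` ideal_exp m 2) ->
  exists (S T : comNzRingType) (mS : set S) (mT : set T),
    [/\ artinian_gorenstein_local mS, artinian_gorenstein_local mT,
        loewy_length mS = loewy_length m, loewy_length mT = 2%N &
        is_connected_sum R mS mT].
Proof.
move=> [m_local hR _ [d hd]] l3 not_sub.
have hm := local_residually_field m_local.
have [ml ml1] : ideal_exp m (loewy_length m) <> [set 0] /\
    ideal_exp m (loewy_length m).+1 = [set 0].
  by apply: loewy_lengthP; apply: leq_trans l3.
have mld := socle_sub_loewy hm hd ml ml1.
have [W [hW W2 mW WZ [splitW Wd]]] :=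
  socle_complement hm hR hd (ltnW l3) mld ml1 not_sub.
(* w u is a choice of W-component, determined only up to the socle; outside m it is
   unconstrained. *)
have /choice[w wP] : forall u, exists x, m u -> W x /\ ann W (u - x).
  move=> u; have [/splitW[x Wx Zx]|nu] := pselect (m u); first by exists x.
  by exists 0.
have Ww u (mu : m u) : W (w u) := (wP u mu).1.
have Zw u (mu : m u) : ann W (u - w u) := (wP u mu).2.
have w_sym := form_sym Ww Zw.
have [F [pi [pi_surj pi_sq]]] := exists_square_cover hm w_sym (form_square hm W2 Ww).
have [JT [hJT JTL kerJT JT_sq JT_split]] := exists_JT pi_surj hm hd W2 Ww Zw Wd.
have [JS [hJS JSK N0JS JS_soc JS_split]] :=
  exists_JS pi_surj hm hd l3 mld hW W2 mW Ww Zw hJT kerJT.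
have [e ne psi_e] := exists_e pi_surj hm hd l3 mld W2 Zw Wd hJT.
have [f nf pi_f] := exists_f pi_surj mld.
have mSub (J : set F) : J `<=` pi @^-1` m -> ~ J 1.
  by case: hm => _ m1 _ Jm /Jm; rewrite /= rmorph1.
have JT1 : ~ JT 1.
  by apply: mSub => x /JTL; apply: (complement_proper hm hd Wd).
have JS1 : ~ JS 1.
  by apply: mSub => x /JSK; apply: (summand_proper hm hd l3 mld W2).
have [S [qS [qS_surj qSE]]] := quotient_exists hJS JS1.
have [T [qT [qT_surj qTE]]] := quotient_exists hJT JT1.
exists S, T, (qS @` (pi @^-1` m)), (qT @` (pi @^-1` m)).
exact: (quotients_decomposition pi_surj hm hR hd l3 mld ml1 hW W2 mW WZ Ww Zw Wd pi_sq
  hJT JTL kerJT JT_sq JT_split hJS JSK N0JS JS_soc JS_split ne psi_e nf pi_f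
  qS_surj qSE qT_surj qTE).
Qed.

(** * From a connected sum to the annihilator of m^2 *)

Lemma connected_sum_ann_square (R S T : comNzRingType) (m : set R) (mS : set S) (mT : set T) :
    is_local m -> is_local mS -> artinian_gorenstein_local mT ->
    loewy_length mT = 2%N -> is_connected_sum R mS mT ->
  ~ (ann (ideal_exp m 2) `<=` ideal_exp m 2).
Proof.
move=> m_local mS_local [mT_local _ _ _] lT [_ _ [k [pS [pT [[_ pSE] [_ pTE]]]]]].
move=> [dS [dT [dd [_ hdT ddE [I [IE [f f_bij]]]]]]] sub.
have hm := local_residually_field m_local; have [hmi m1 _] := hm.
have hmT := local_residually_field mT_local; have [hmTi _ _] := hmT.
have [mT2 mT3] : ideal_exp mT 2 <> [set 0] /\ ideal_exp mT 3 = [set 0].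
  by rewrite -lT; apply: loewy_lengthP; rewrite lT.
have hT2 : is_ideal (ideal_exp mT 2) by exact: is_ideal_exp.
have dT2 := socle_sub_loewy hmT hdT mT2 mT3.
(* Otherwise mT equals its square, and multiplying by mT gives mT^2 = mT^3 = 0. *)
have [t0 [mt0 nt0]] : exists t, mT t /\ ~ ideal_exp mT 2 t.
  apply: contrapT => h; apply: mT2; rewrite -mT3; apply/seteqP; split; last first.
    exact: ideal_expS_sub.
  have mTsub : mT `<=` ideal_exp mT 2.
    by move=> t mt; apply: contrapT => nt; apply: h; exists t.
  rewrite {1}ideal_exp2 //; apply: ideal_mul_min; first exact: is_ideal_exp.
  by move=> x y mx /mTsub; apply: ideal_mul_sub.
pose q := quotient_map I; pose snd_val (c : fiber_product pS pT) := (fiber_val c).2.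
have q0 c : q c = 0 -> exists a, c = a * dd.
  move=> /quotient_map_eq0 cI; have : ideal_gen [set dd] c by rewrite -IE.
  by rewrite ideal_gen1 => -[a _ <-]; exists a.
have f_inj : injective f by exact: bij_inj.
have f_surj y : exists x, f x = y.
  by case: f_bij => g _ gK; exists (g y).
have lift r : exists c, q c = f r by exact: quotient_map_surj.
have pTm t : mT t <-> pT t = 0 by rewrite -pTE.
have pSm s : mS s <-> pS s = 0 by rewrite -pSE.
(* If the second component is a unit, so is the first, as both have the same residue; their inverses
   form an element of the fiber product, and r would be a unit. *)
have m_snd r c : m r -> q c = f r -> mT (snd_val c).
  move=> mr cr; apply: contrapT => nc2.
  have c12 : pS (fiber_val c).1 = pT (snd_val c).
    by rewrite /snd_val; case: (c) => c' c'P; exact/eqP.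
  have nc1 : ~ mS (fiber_val c).1 by rewrite pSm c12 -pTm.
  have [a a1] := local_unit mS_local nc1; have [b b1] := local_unit mT_local nc2.
  have abP : (a, b) \in fiber_pred pS pT.
    rewrite unfold_in /fiber_pred /=; apply/eqP; apply: (mulfI (x := pT (snd_val c))).
      by apply/eqP => /pTm.
    by rewrite -{1}c12 -!rmorphM a1 b1 !rmorph1.
  have cab : c * FiberProduct abP = 1.
    by apply: val_inj; rewrite /= [LHS]surjective_pairing /= a1 b1.
  have [r' r'E] := f_surj (q (FiberProduct abP)).
  apply: m1; have <- : r * r' = 1; last exact: ideal_mulr.
  by apply: f_inj; rewrite rmorphM -cr r'E -rmorphM cab !rmorph1.
have c0P : (0, t0) \in fiber_pred pS pT.
  by rewrite unfold_in /fiber_pred /= rmorph0 eq_sym; apply/eqP/pTm.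
have [r0 r0E] := f_surj (q (FiberProduct c0P)).
have r02 : ideal_exp m 2 r0.
  apply: sub; apply: ann_exp2 => // a b ma mb; apply: f_inj; rewrite rmorph0.
  have [ca caE] := lift a; have [cb cbE] := lift b.
  rewrite !rmorphM r0E -caE -cbE -!rmorphM -[RHS](rmorph0 q); congr (q _).
  apply: val_inj; rewrite /= [LHS]surjective_pairing /=; congr pair; first by rewrite mul0r.
  have : ideal_exp mT 3 (t0 * (snd_val ca * snd_val cb)).
    apply: ideal_mul_sub => //.
    by apply: ideal_exp2_sub => //; [exact: m_snd ma _|exact: m_snd mb _].
  by rewrite mT3.
have [c [cE c2]] : exists c, q c = f r0 /\ ideal_exp mT 2 (snd_val c).
  pose X : set R := [set r | exists c, q c = f r /\ ideal_exp mT 2 (snd_val c)].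
  suff sub2 : ideal_exp m 2 `<=` X by exact: sub2.
  rewrite ideal_exp2 //; apply: ideal_mul_min => [|a b ma mb]; last first.
    have [ca caE] := lift a; have [cb cbE] := lift b; exists (ca * cb).
    by rewrite !rmorphM caE cbE; split=> //; apply: ideal_exp2_sub => //;
      [exact: m_snd ma _|exact: m_snd mb _].
  split=> [|x y [c [cx c2]] [c' [cy c'2]]|a x [c [cx c2]]].
  - by exists 0; rewrite !rmorph0; split=> //; apply: (ideal_0 hT2).
  - by exists (c + c'); rewrite !rmorphD cx cy; split=> //; apply: (idealD hT2).
  - have [ca caE] := lift a; exists (ca * c); rewrite !rmorphM caE cx; split=> //.
    exact: (ideal_mull _ hT2).
(* Two lifts of one class differ by a multiple of (dS, - dT), and dT lies in mT^2, so membership of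
   the second component in mT^2 does not depend on the lift. *)
have [a aE] : exists a, FiberProduct c0P - c = a * dd.
  by apply: q0; rewrite rmorphB cE r0E subrr.
apply: nt0; have /(congr1 snd_val) := aE; rewrite /snd_val /= ddE /= => tE.
apply: (idealB_cancel hT2 c2); rewrite tE mulrN -mulNr; exact: (ideal_mull _ hT2).
Qed.

Theorem theorem2 (R : comNzRingType) (m : set R)
    (hR : artinian_gorenstein_local m) (hll : (3 <= loewy_length m)%N) :
  (exists (S T : comNzRingType) (mS : set S) (mT : set T),
     [/\ artinian_gorenstein_local mS, artinian_gorenstein_local mT,
         loewy_length mS = loewy_length m, loewy_length mT = 2%N &
         is_connected_sum R mS mT])
  <-> ~ (ann (ideal_exp m 2) `<=` ideal_exp m 2).
Proof.
split; last exact: connected_sum_exists.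
case: hR => m_local _ _ _ [S [T [mS [mT [[mS_local _ _ _] hT _ lT RST]]]]].
exact: connected_sum_ann_square RST.
Qed.
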